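(* There is a constant $C$ such that for every set $S \subset \mathbb{N}$ (finite or infinite) with $H(S)<\infty$, $$I(S) \leq 2\cdot H(S) + C\log_2(H(S)+2) + C.$$
   Context: A deterministic enumerating machine $D$ is an algorithm that takes a finite binary string $x$ as input and, possibly running forever, outputs (enumerates) natural numbers; the set it enumerates on $x$ is the set of all numbers it ever outputs (possibly infinite). For a set $S\subset\mathbb{N}$, $I_D(S)$ is the minimum length of a binary string $x$ such that $D$ on input $x$ enumerates exactly $S$ ($I_D(S)=\infty$ if none exists). There is a universal machine $D_0$: for every $D$ there is a constant $c$ with $I_{D_0}(S) \le I_D(S)+c$ for all $S$ (note the direction: $D_0$ is at most a constant worse than any $D$). Define $I(S) = I_{D_0}(S)$ for a fixed such universal $D_0$ (well defined up to an additive constant). A probabilistic enumerating machine $M$ is an algorithm that may request arbitrarily many independent uniformly random bits and, possibly running forever, enumerates natural numbers; thus it induces a map from the Cantor space $\{0,1\}^{\mathbb{N}}$ (with the uniform measure) to subsets of $\mathbb{N}$, sending a bit sequence $w$ to the set enumerated when $w$ supplies the random bits. Define $H_M(S) = -\log_2 \Pr[M \text{ enumerates exactly } S]$ (infinite if the probability is $0$). There is an optimal machine $M_0$: for every $M$ there is a constant $c$ with $H_{M_0}(S) \le H_M(S) + c$ for all $S$. Define $H(S) = H_{M_0}(S)$ for a fixed such optimal $M_0$ (well defined up to an additive constant). *)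

(* Defs.v *)
From Stdlib Require Import Reals List Arith.
Open Scope R_scope.

(** * A model of computation: mu-recursive programs with an oracle.
    Programs act on argument lists (missing arguments default to 0);
    [Oracle] returns the bit w(x) (as 0/1) of the oracle [w : nat -> bool]
    at position x = first argument.  Evaluation is a big-step relation,
    hence programs denote partial (oracle-)computable functions. *)
Inductive prog : Type :=
| Zero : prog
| Succ : prog
| Proj : nat -> prog
| Oracle : prog
| Comp : prog -> list prog -> prog
| PrimRec : prog -> prog -> prog
| Mu : prog -> prog.

Inductive eval (w : nat -> bool) : prog -> list nat -> nat -> Prop :=
| eZero xs : eval w Zero xs 0
| eSucc xs : eval w Succ xs (S (hd 0%nat xs))
| eProj i xs : eval w (Proj i) xs (nth i xs 0%nat)
| eOracle xs : eval w Oracle xs (if w (hd 0%nat xs) then 1%nat else 0%nat)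
| eComp f gs xs ys y :
    evals w gs xs ys -> eval w f ys y -> eval w (Comp f gs) xs y
| ePR0 f g xs y : eval w f xs y -> eval w (PrimRec f g) (0%nat :: xs) y
| ePRS f g n xs z y :
    eval w (PrimRec f g) (n :: xs) z -> eval w g (n :: z :: xs) y ->
    eval w (PrimRec f g) (S n :: xs) y
| eMu f xs n :
    eval w f (n :: xs) 0%nat ->
    (forall m, (m < n)%nat -> exists k, eval w f (m :: xs) (S k)) ->
    eval w (Mu f) xs n
with evals (w : nat -> bool) : list prog -> list nat -> list nat -> Prop :=
| esNil xs : evals w nil xs nil
| esCons g gs xs y ys :
    eval w g xs y -> evals w gs xs ys -> evals w (g :: gs) xs (y :: ys).

(** Bijective coding of finite binary strings by natural numbers. *)
Fixpoint code (x : list bool) : nat :=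
  match x with
  | nil => 0%nat
  | b :: x' => (2 * code x' + (if b then 2 else 1))%nat
  end.

(** Sets of naturals are predicates; "enumerates exactly S" is pointwise
    equivalence. A machine [p] emits output [n] at step [t] when it
    returns [S n] on step-argument [t] (0 = no output at that step). *)

(** Deterministic enumerating machine [D] (no randomness: constant oracle),
    on input string [x], enumerates exactly [S]. *)
Definition det_enumerates (D : prog) (x : list bool) (S : nat -> Prop) : Prop :=
  forall n, S n <-> exists t, eval (fun _ => false) D (code x :: t :: nil) (Datatypes.S n).

(** [D0] is universal: I_{D0}(S) <= I_D(S) + c for every D (with I = oo
    when no description exists). *)
Definition universal_det (D0 : prog) : Prop :=
  forall D : prog, exists c : nat, forall (S : nat -> Prop) (x : list bool),
    det_enumerates D x S ->
    exists x', det_enumerates D0 x' S /\ (length x' <= length x + c)%nat.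

Definition prob_enumerates (M : prog) (w : nat -> bool) (S : nat -> Prop) : Prop :=
  forall n, S n <-> exists t, eval w M (t :: nil) (Datatypes.S n).

(** Uniform (coin-flipping) measure on Cantor space, via its outer measure:
    infimum of total weights sum_i 2^-|sigma_i| of covers by cylinders. *)
Definition extends (w : nat -> bool) (s : list bool) : Prop :=
  forall i, (i < length s)%nat -> w i = nth i s false.

Fixpoint partial_weight (sigma : nat -> list bool) (N : nat) : R :=
  match N with
  | O => 0
  | Datatypes.S N' => partial_weight sigma N' + (/ 2) ^ length (sigma N')
  end.

Definition cover_bound (A : (nat -> bool) -> Prop) (s : R) : Prop :=
  exists sigma : nat -> list bool,
    (forall w, A w -> exists i, extends w (sigma i)) /\
    (forall N, partial_weight sigma N <= s).

Definition is_glb (E : R -> Prop) (m : R) : Prop :=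
  (forall s, E s -> m <= s) /\ (forall m', (forall s, E s -> m' <= s) -> m' <= m).

Definition cantor_measure (A : (nat -> bool) -> Prop) (p : R) : Prop :=
  is_glb (cover_bound A) p.

Definition prob_of (M : prog) (S : nat -> Prop) (p : R) : Prop :=
  cantor_measure (fun w => prob_enumerates M w S) p.

Definition log2 (x : R) : R := ln x / ln 2.

Definition H_is (M : prog) (S : nat -> Prop) (h : R) : Prop :=
  exists p, prob_of M S p /\ 0 < p /\ h = - log2 p.

Definition optimal_prob (M0 : prog) : Prop :=
  forall M : prog, exists c : R, forall (S : nat -> Prop) (h : R),
    H_is M S h -> exists h0, H_is M0 S h0 /\ h0 <= h + c.

(* Main.v *)
(* Let [R = 2 ^ k] with [1 / R] less than the probability of [S]; it suffices to
   enumerate online [R ^ 2] sets, one of which is [S], since then [2 k] bits (whose number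
   gives [k]) describe [S]. The sets are the trajectories of [R ^ 2] tokens that move
   upwards among finite sets while the machine is simulated on all random strings.

   A request of level [N] at stage [t] is a set [v] within [0, N) such that a fraction
   [>= 1 / R] of the strings, not yet served at a level [>= N], have produced exactly [v]
   below [N]; these strings are then labelled by [v], and a token must sit at [v]. Labels
   only grow. If a random sequence [w] is served infinitely often, its labels tend to the
   set enumerated by [w], and so does some token. If no [w] enumerating [S] is served
   infinitely often, continuity of the outer measure yields a level [N] at which more than
   a fraction [1 / R] of the strings is waiting forever, so that requests of level [N] are
   made infinitely often; but each of them uses up a fraction [1 / R] of the strings.

   A token can be moved to [v] only from below. The choice of the token maintains Hall's
   condition: every set [W] of strings contains at most [R ^ 2] times its measure many
   cones, the cone of a token being the set of strings labelled above it. If no choice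
   did, each of the at most [R] maximal positions below [v] would be excluded by a tight
   set, and submodularity would make their intersection almost tight although it contains
   no cone meeting the strings of the request. *)

Require Import Defs.
From Stdlib Require Import Reals List Arith ZArith Lia Bool Lra.
From Stdlib Require Import Classical ClassicalEpsilon.
Import ListNotations.
Open Scope nat_scope.

(** The generated principle gives no hypothesis about the programs in the list of [Comp]; the inner
    fixpoint supplies it as a [Forall]. *)
Fixpoint prog_nested_ind (P : prog -> Prop)
  (HZ : P Zero) (HS : P Succ) (HP : forall i, P (Proj i)) (HO : P Oracle)
  (HC : forall f gs, P f -> Forall P gs -> P (Comp f gs))
  (HR : forall f g, P f -> P g -> P (PrimRec f g))
  (HM : forall f, P f -> P (Mu f)) (p : prog) : P p :=
  let rec := prog_nested_ind P HZ HS HP HO HC HR HM in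
  match p with
  | Zero => HZ
  | Succ => HS
  | Proj i => HP i
  | Oracle => HO
  | Comp f gs => HC f gs (rec f)
      ((fix go l : Forall P l :=
          match l with
          | nil => Forall_nil P
          | g :: l' => Forall_cons g (rec g) (go l')
          end) gs)
  | PrimRec f g => HR f g (rec f) (rec g)
  | Mu f => HM f (rec f)
  end.

(** * Bounded operators *)

(** Written as a [nat_rect] to match [PrimRec]; the other bounded operators reduce to this one, so
    their computability follows from that of [bsum]. *)
Definition bsum (n : nat) (F : nat -> nat) : nat :=
  nat_rect (fun _ => nat) 0 (fun i z => z + F i) n.
Definition cnt (n : nat) (P : nat -> bool) : nat := bsum n (fun i => Nat.b2n (P i)).
Definition ball (n : nat) (P : nat -> bool) : bool :=
  cnt n (fun i => negb (P i)) =? 0.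
Definition bex (n : nat) (P : nat -> bool) : bool := negb (cnt n P =? 0).
(* The least [i < n] with [P i], and [n] if there is none. *)
Definition bmin (n : nat) (P : nat -> bool) : nat :=
  bsum n (fun i => Nat.b2n (negb (bex (S i) P))).

Lemma bsum_S n F : bsum (S n) F = bsum n F + F n.
Proof. reflexivity. Qed.

Lemma cnt_S n P : cnt (S n) P = cnt n P + Nat.b2n (P n).
Proof. reflexivity. Qed.

Lemma bsum_ext n F G : (forall i, i < n -> F i = G i) -> bsum n F = bsum n G.
Proof.
  induction n as [|n IH]; intros H; [reflexivity|].
  rewrite !bsum_S, IH, H; auto.
Qed.

Lemma cnt_ext n P Q : (forall i, i < n -> P i = Q i) -> cnt n P = cnt n Q.
Proof. intros H; apply bsum_ext; intros i Hi; now rewrite H. Qed.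

Lemma cnt_le n P Q :
  (forall i, i < n -> P i = true -> Q i = true) -> cnt n P <= cnt n Q.
Proof.
  induction n as [|n IH]; intros H; [reflexivity|].
  rewrite !cnt_S. assert (cnt n P <= cnt n Q) by (apply IH; auto).
  specialize (H n (Nat.lt_succ_diag_r n)).
  destruct (P n), (Q n); simpl; lia.
Qed.

Lemma cnt_true n : cnt n (fun _ => true) = n.
Proof. induction n as [|n IH]; [reflexivity|]. rewrite cnt_S, IH; simpl; lia. Qed.

Lemma cnt_bound n P : cnt n P <= n.
Proof. rewrite <- (cnt_true n) at 2. now apply cnt_le. Qed.

Lemma cnt_0 n P : cnt n P = 0 <-> forall i, i < n -> P i = false.
Proof.
  induction n as [|n IH]; [split; [lia|reflexivity]|].
  rewrite cnt_S. split.
  - intros H i Hi. destruct (Nat.eq_dec i n) as [->|].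
    + destruct (P n); simpl in H; [lia|reflexivity].
    + apply IH; lia.
  - intros H. rewrite (H n), (proj2 IH); auto.
Qed.

Lemma cnt_union_inter n P Q :
  cnt n (fun i => P i || Q i) + cnt n (fun i => P i && Q i) = cnt n P + cnt n Q.
Proof.
  induction n as [|n IH]; [reflexivity|].
  rewrite !cnt_S. destruct (P n), (Q n); simpl; lia.
Qed.

Lemma cnt_diff n P Q :
  cnt n (fun i => P i && negb (Q i)) + cnt n (fun i => P i && Q i) = cnt n P.
Proof.
  induction n as [|n IH]; [reflexivity|].
  rewrite !cnt_S. destruct (P n), (Q n); simpl; lia.
Qed.

Lemma cnt_add n1 n2 P : cnt (n1 + n2) P = cnt n1 P + cnt n2 (fun i => P (n1 + i)).
Proof.
  induction n2 as [|n2 IH].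
  - rewrite !Nat.add_0_r. reflexivity.
  - rewrite Nat.add_succ_r, !cnt_S, IH. lia.
Qed.

Lemma cnt_remove n P Q j :
  (forall i, i < n -> i <> j -> P i = true -> Q i = true) -> cnt n P <= S (cnt n Q).
Proof.
  intros H. induction n as [|n IH]; [simpl; lia|].
  rewrite !cnt_S. destruct (Nat.eq_dec n j) as [->|Hn].
  - assert (cnt j P <= cnt j Q) by (apply cnt_le; intros; apply H; auto; lia).
    destruct (P j), (Q j); simpl; lia.
  - assert (cnt n P <= S (cnt n Q)) by (apply IH; auto).
    specialize (H n (Nat.lt_succ_diag_r n) Hn).
    destruct (P n), (Q n); simpl; lia.
Qed.

Lemma ball_spec n P : ball n P = true <-> forall i, i < n -> P i = true.
Proof.
  unfold ball. rewrite Nat.eqb_eq, cnt_0.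
  split; intros H i Hi; specialize (H i Hi); now destruct (P i).
Qed.

Lemma bex_spec n P : bex n P = true <-> exists i, i < n /\ P i = true.
Proof.
  unfold bex. rewrite negb_true_iff, Nat.eqb_neq, cnt_0. split.
  - intros H. induction n as [|n IH].
    + exfalso; apply H; lia.
    + destruct (P n) eqn:E; [exists n; auto|].
      destruct IH as (i & Hi & Hp).
      * intros K; apply H; intros i Hi.
        destruct (Nat.eq_dec i n) as [->|]; [auto|apply K; lia].
      * exists i; auto.
  - intros (i & Hi & Hp) K. now rewrite K in Hp.
Qed.

Lemma bsum_b2n_prefix n j : bsum n (fun i => Nat.b2n (i <? j)) = Nat.min n j.
Proof.
  induction n as [|n IH]; [reflexivity|]. rewrite bsum_S, IH.
  destruct (Nat.ltb_spec n j); cbn [Nat.b2n]; lia.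
Qed.

Lemma bmin_unique n P j :
  j <= n -> (forall i, i < j -> P i = false) -> (j < n -> P j = true) -> bmin n P = j.
Proof.
  intros Hj Hlt Hat. unfold bmin.
  rewrite (bsum_ext n _ (fun i => Nat.b2n (i <? j))), bsum_b2n_prefix; [lia|].
  intros i Hi. f_equal. apply eq_true_iff_eq.
  rewrite negb_true_iff, Nat.ltb_lt, <- not_true_iff_false, bex_spec. split.
  - intros H. destruct (Nat.lt_ge_cases i j) as [|Hge]; [assumption|].
    exfalso; apply H. exists j. split; [lia|apply Hat; lia].
  - intros H (i' & Hi' & Hp). rewrite Hlt in Hp; [discriminate|lia].
Qed.

Lemma bmin_spec n P :
  bmin n P <= n /\ (forall i, i < bmin n P -> P i = false) /\
  (bmin n P < n -> P (bmin n P) = true).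
Proof.
  assert (exists j, j <= n /\ (forall i, i < j -> P i = false) /\ (j < n -> P j = true))
    as (j & H1 & H2 & H3).
  { induction n as [|n (j & H1 & H2 & H3)]; [exists 0; repeat split; lia|].
    destruct (Nat.eq_dec j n) as [->|].
    - destruct (P n) eqn:E.
      + exists n; repeat split; auto.
      + exists (S n). repeat split; [lia| |lia].
        intros i Hi. destruct (Nat.eq_dec i n) as [->|]; [auto|apply H2; lia].
    - exists j; repeat split; auto; intros; apply H3; lia. }
  rewrite (bmin_unique n P j); auto.
Qed.

Lemma bmin_found n P : (exists i, i < n /\ P i = true) -> bmin n P < n.
Proof.
  intros (i & Hi & Hp). destruct (bmin_spec n P) as (_ & H & _).
  destruct (Nat.lt_ge_cases (bmin n P) n) as [|Hge]; [assumption|].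
  rewrite H in Hp; [discriminate|lia].
Qed.

(** * Closure properties of the program-computable functions *)

(* Functions of an environment; variables are de Bruijn indices into it, so that
   [tl] skips a bound variable. *)
Definition cpt (F : list nat -> nat) : Prop :=
  exists p k,
    (forall e e', (forall i, i < k -> nth i e 0 = nth i e' 0) -> F e = F e') /\
    (forall w e, eval w p e (F e)).

Definition cptb (P : list nat -> bool) : Prop := cpt (fun e => Nat.b2n (P e)).

Lemma cpt_ext F G : (forall e, F e = G e) -> cpt F -> cpt G.
Proof.
  intros H (p & k & Hk & Hp). exists p, k. split.
  - intros e e' He. rewrite <- !H. auto.
  - intros w e. rewrite <- H. auto.
Qed.

Lemma nth_tl {A} (i : nat) (l : list A) (d : A) : nth i (tl l) d = nth (S i) l d.
Proof. destruct l; [destruct i|]; reflexivity. Qed.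

Lemma cpt_proj i : cpt (fun e => nth i e 0).
Proof. exists (Proj i), (S i). split; [auto|constructor]. Qed.

Lemma evals_map (w : nat -> bool) (e : list nat) (gs : list prog) (Gs : list (list nat -> nat)) :
  Forall2 (fun g G => eval w g e (G e)) gs Gs -> evals w gs e (map (fun G => G e) Gs).
Proof. induction 1; simpl; constructor; auto. Qed.

Lemma cpt_uniform Gs :
  Forall cpt Gs ->
  exists gs k,
    (forall w e, Forall2 (fun g (G : list nat -> nat) => eval w g e (G e)) gs Gs) /\
    (forall e e', (forall i, i < k -> nth i e 0 = nth i e' 0) ->
       map (fun G => G e) Gs = map (fun G => G e') Gs).
Proof.
  induction 1 as [|G Gs (p & k & Hk & Hp) _ (gs & k' & H1 & H2)].
  - exists [], 0. split; [constructor|reflexivity].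
  - exists (p :: gs), (Nat.max k k'). split.
    + intros w e; constructor; auto.
    + intros e e' He; simpl. f_equal; [apply Hk|apply H2]; intros; apply He; lia.
Qed.

Lemma cpt_comp F Gs : cpt F -> Forall cpt Gs -> cpt (fun e => F (map (fun G => G e) Gs)).
Proof.
  intros (p & k & Hk & Hp) HG. destruct (cpt_uniform Gs HG) as (gs & k' & H1 & H2).
  exists (Comp p gs), k'. split.
  - intros e e' He. now rewrite (H2 e e' He).
  - intros w e. econstructor; [apply evals_map, H1|apply Hp].
Qed.

Lemma cpt_comp1 F A : cpt F -> cpt A -> cpt (fun e => F [A e]).
Proof. intros HF HA. apply (cpt_comp F [A]); auto. Qed.

Lemma cpt_succ A : cpt A -> cpt (fun e => S (A e)).
Proof.
  intros HA. refine (cpt_comp1 (fun e => S (nth 0 e 0)) A _ HA).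
  exists Succ, 1. split.
  - intros e e' He. now rewrite He by lia.
  - intros w e. destruct e; apply eSucc.
Qed.

Lemma cpt_const c : cpt (fun _ => c).
Proof.
  induction c as [|c IH]; [|now apply (cpt_succ (fun _ => c))].
  exists Zero, 0. split; [reflexivity|constructor].
Qed.

Definition prefix (k : nat) (e : list nat) : list nat := map (fun i => nth i e 0) (seq 0 k).

Lemma nth_prefix k e i : i < k -> nth i (prefix k e) 0 = nth i e 0.
Proof.
  intros Hi. unfold prefix.
  rewrite (nth_indep _ 0 (nth 0 e 0)) by now rewrite length_map, length_seq.
  rewrite (map_nth (fun i => nth i e 0)), seq_nth; auto.
Qed.

Lemma evals_prefix w k e : evals w (map Proj (seq 0 k)) e (prefix k e).
Proof.
  unfold prefix. generalize 0 at 1 3. induction k as [|k IH]; intros j; simpl; constructor.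
  - constructor.
  - apply IH.
Qed.

Lemma cpt_rec A G N :
  cpt A -> cpt G -> cpt N ->
  cpt (fun e => nat_rect (fun _ => nat) (A e) (fun n z => G (n :: z :: e)) (N e)).
Proof.
  intros (pA & kA & HkA & HA) (pG & kG & HkG & HG) (pN & kN & HkN & HN).
  set (k := kA + kG + kN).
  exists (Comp (PrimRec pA pG) (pN :: map Proj (seq 0 k))), k. split.
  - intros e e' He. rewrite (HkN e e') by (intros; apply He; lia).
    induction (N e') as [|n IH]; simpl; [apply HkA; intros; apply He; lia|].
    rewrite IH. apply HkG. intros [|[|i]] Hi; simpl; auto. apply He; lia.
  - intros w e. econstructor; [constructor; [apply HN|apply evals_prefix]|].
    induction (N e) as [|n IH]; simpl.
    + apply ePR0. rewrite (HkA e (prefix k e)); [apply HA|].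
      intros i Hi. symmetry; apply nth_prefix; lia.
    + eapply ePRS; [apply IH|].
      match goal with |- eval _ _ (_ :: ?z :: _) _ =>
        rewrite (HkG (n :: z :: e) (n :: z :: prefix k e)); [apply HG|] end.
      intros [|[|i]] Hi; simpl; auto. symmetry; apply nth_prefix; lia.
Qed.

Lemma cpt_subst (r : list nat -> list nat) F :
  (forall i, cpt (fun e => nth i (r e) 0)) -> cpt F -> cpt (fun e => F (r e)).
Proof.
  intros Hr HF. pose proof HF as (_ & k & Hk & _).
  apply (cpt_ext (fun e => F (map (fun G => G e)
           (map (fun i e => nth i (r e) 0) (seq 0 k))))).
  - intros e. apply Hk. intros i Hi. rewrite map_map.
    exact (nth_prefix k (r e) i Hi).
  - apply cpt_comp; [exact HF|]. apply Forall_map, Forall_forall. auto.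
Qed.

Lemma cpt_tl A : cpt A -> cpt (fun e => A (tl e)).
Proof.
  apply (cpt_subst (@tl nat)). intros i.
  apply (cpt_ext (fun e => nth (S i) e 0)); [intros e; symmetry; apply nth_tl|apply cpt_proj].
Qed.

(** Under [j] bounded operators an outer variable shows up as an entry of the [j]-fold tail. *)
Lemma cpt_var i j : cpt (fun e => nth i (Nat.iter j (@tl nat) e) 0).
Proof.
  apply (cpt_ext (fun e => nth (j + i) e 0)); [|apply cpt_proj].
  intros e. revert i. induction j as [|j IH]; intros i; simpl; [reflexivity|].
  rewrite nth_tl, <- IH. f_equal. lia.
Qed.

Definition cpt1 (f : nat -> nat) := cpt (fun e => f (nth 0 e 0)).
Definition cpt2 (f : nat -> nat -> nat) := cpt (fun e => f (nth 0 e 0) (nth 1 e 0)).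
Definition cpt3 (f : nat -> nat -> nat -> nat) :=
  cpt (fun e => f (nth 0 e 0) (nth 1 e 0) (nth 2 e 0)).
Definition cpt4 (f : nat -> nat -> nat -> nat -> nat) :=
  cpt (fun e => f (nth 0 e 0) (nth 1 e 0) (nth 2 e 0) (nth 3 e 0)).

Lemma cpt1_app f A : cpt1 f -> cpt A -> cpt (fun e => f (A e)).
Proof. intros Hf HA. exact (cpt_comp _ [A] Hf ltac:(auto)). Qed.

Lemma cpt2_app f A B : cpt2 f -> cpt A -> cpt B -> cpt (fun e => f (A e) (B e)).
Proof. intros Hf HA HB. exact (cpt_comp _ [A; B] Hf ltac:(auto)). Qed.

Lemma cpt3_app f A B C :
  cpt3 f -> cpt A -> cpt B -> cpt C -> cpt (fun e => f (A e) (B e) (C e)).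
Proof. intros Hf HA HB HC. exact (cpt_comp _ [A; B; C] Hf ltac:(auto)). Qed.

Lemma cpt4_app f A B C E :
  cpt4 f -> cpt A -> cpt B -> cpt C -> cpt E ->
  cpt (fun e => f (A e) (B e) (C e) (E e)).
Proof. intros Hf HA HB HC HE. exact (cpt_comp _ [A; B; C; E] Hf ltac:(auto)). Qed.

(* The body of a bounded operator is given as [F i e], to be computed from the
   environment [i :: e]. *)
Lemma cpt_nat_rect A N (G : nat -> nat -> list nat -> nat) :
  cpt A -> cpt (fun e => G (nth 0 e 0) (nth 1 e 0) (tl (tl e))) -> cpt N ->
  cpt (fun e => nat_rect (fun _ => nat) (A e) (fun n z => G n z e) (N e)).
Proof. intros HA HG HN. exact (cpt_rec A _ N HA HG HN). Qed.

Lemma cpt_add A B : cpt A -> cpt B -> cpt (fun e => A e + B e).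
Proof.
  intros HA HB.
  apply (cpt_ext (fun e => nat_rect (fun _ => nat) (A e) (fun n z => S z) (B e))).
  - intros e. induction (B e) as [|n IH]; simpl; lia.
  - apply (cpt_nat_rect A B (fun n z e => S z)); auto. apply cpt_succ, cpt_proj.
Qed.

Lemma cpt_mul A B : cpt A -> cpt B -> cpt (fun e => A e * B e).
Proof.
  intros HA HB.
  apply (cpt_ext (fun e => nat_rect (fun _ => nat) 0 (fun n z => z + A e) (B e))).
  - intros e. induction (B e) as [|n IH]; simpl; lia.
  - apply (cpt_nat_rect (fun _ => 0) B (fun n z e => z + A e)); auto using cpt_const.
    apply cpt_add; [apply cpt_proj|apply (cpt_tl (fun e => A (tl e))), cpt_tl, HA].
Qed.

Lemma cpt_pow A B : cpt A -> cpt B -> cpt (fun e => A e ^ B e).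
Proof.
  intros HA HB.
  apply (cpt_ext (fun e => nat_rect (fun _ => nat) 1 (fun n z => A e * z) (B e))).
  - intros e. induction (B e) as [|n IH]; simpl; [|rewrite IH]; reflexivity.
  - apply (cpt_nat_rect (fun _ => 1) B (fun n z e => A e * z)); auto using cpt_const.
    apply cpt_mul; [apply (cpt_tl (fun e => A (tl e))), cpt_tl, HA|apply cpt_proj].
Qed.

Lemma cpt_pred A : cpt A -> cpt (fun e => Nat.pred (A e)).
Proof.
  intros HA.
  apply (cpt_ext (fun e => nat_rect (fun _ => nat) 0 (fun n z => n) (A e))).
  - intros e. destruct (A e); reflexivity.
  - apply (cpt_nat_rect (fun _ => 0) A (fun n z e => n)); auto using cpt_const, cpt_proj.
Qed.

Lemma cpt_sub A B : cpt A -> cpt B -> cpt (fun e => A e - B e).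
Proof.
  intros HA HB.
  apply (cpt_ext (fun e => nat_rect (fun _ => nat) (A e) (fun n z => Nat.pred z) (B e))).
  - intros e. induction (B e) as [|n IH]; cbn [nat_rect]; lia.
  - apply (cpt_nat_rect A B (fun n z e => Nat.pred z)); auto.
    apply cpt_pred, cpt_proj.
Qed.

Lemma cptb_leb A B : cpt A -> cpt B -> cptb (fun e => A e <=? B e).
Proof.
  intros HA HB. apply (cpt_ext (fun e => 1 - (A e - B e))).
  - intros e. destruct (Nat.leb_spec (A e) (B e)); cbn [Nat.b2n]; lia.
  - apply cpt_sub; [apply cpt_const|now apply cpt_sub].
Qed.

Lemma cptb_ltb A B : cpt A -> cpt B -> cptb (fun e => A e <? B e).
Proof. intros HA HB. apply (cptb_leb (fun e => S (A e)) B); auto using cpt_succ. Qed.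

Lemma cptb_andb P Q : cptb P -> cptb Q -> cptb (fun e => P e && Q e).
Proof.
  intros HP HQ. apply (cpt_ext (fun e => Nat.b2n (P e) * Nat.b2n (Q e))).
  - intros e. now destruct (P e), (Q e).
  - now apply cpt_mul.
Qed.

Lemma cptb_negb P : cptb P -> cptb (fun e => negb (P e)).
Proof.
  intros HP. apply (cpt_ext (fun e => 1 - Nat.b2n (P e))).
  - intros e. now destruct (P e).
  - apply cpt_sub; auto using cpt_const.
Qed.

Lemma cptb_ext P Q : (forall e, P e = Q e) -> cptb P -> cptb Q.
Proof. intros H. apply cpt_ext. intros e. now rewrite H. Qed.

Lemma cptb_implb P Q : cptb P -> cptb Q -> cptb (fun e => implb (P e) (Q e)).
Proof.
  intros HP HQ. apply (cptb_ext (fun e => negb (P e && negb (Q e)))).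
  - intros e. now destruct (P e), (Q e).
  - auto using cptb_negb, cptb_andb.
Qed.

Lemma cptb_eqb A B : cpt A -> cpt B -> cptb (fun e => A e =? B e).
Proof.
  intros HA HB. apply (cptb_ext (fun e => (A e <=? B e) && (B e <=? A e))).
  - intros e. apply eq_true_iff_eq.
    rewrite andb_true_iff, !Nat.leb_le, Nat.eqb_eq. lia.
  - auto using cptb_andb, cptb_leb.
Qed.

Lemma cpt_if P A B : cptb P -> cpt A -> cpt B -> cpt (fun e => if P e then A e else B e).
Proof.
  intros HP HA HB.
  apply (cpt_ext (fun e => Nat.b2n (P e) * A e + (1 - Nat.b2n (P e)) * B e)).
  - intros e. destruct (P e); simpl; lia.
  - apply cpt_add; apply cpt_mul; auto. apply cpt_sub; auto using cpt_const.
Qed.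

(** Drops the accumulator, the second entry, from the environment of a recursion body. *)
Lemma cpt_skip1 i : cpt (fun e => nth i (nth 0 e 0 :: tl (tl e)) 0).
Proof. destruct i as [|i]; [apply cpt_proj|apply (cpt_var i 2)]. Qed.

Lemma cpt_bsum N (F : nat -> list nat -> nat) :
  cpt N -> cpt (fun e => F (nth 0 e 0) (tl e)) ->
  cpt (fun e => bsum (N e) (fun i => F i e)).
Proof.
  intros HN HF. apply (cpt_nat_rect (fun _ => 0) N (fun i z e => z + F i e));
    auto using cpt_const.
  apply cpt_add; [apply cpt_proj|].
  apply (cpt_subst (fun e => nth 0 e 0 :: tl (tl e)) (fun e => F (nth 0 e 0) (tl e)));
    auto using cpt_skip1.
Qed.

Lemma cpt_cnt N (P : nat -> list nat -> bool) :
  cpt N -> cptb (fun e => P (nth 0 e 0) (tl e)) ->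
  cpt (fun e => cnt (N e) (fun i => P i e)).
Proof. intros HN HP. now apply (cpt_bsum N (fun i e => Nat.b2n (P i e))). Qed.

Lemma cptb_ball N (P : nat -> list nat -> bool) :
  cpt N -> cptb (fun e => P (nth 0 e 0) (tl e)) ->
  cptb (fun e => ball (N e) (fun i => P i e)).
Proof.
  intros HN HP. apply cptb_eqb; [|apply cpt_const].
  apply (cpt_cnt N (fun i e => negb (P i e))); auto. now apply cptb_negb.
Qed.

Lemma cptb_bex N (P : nat -> list nat -> bool) :
  cpt N -> cptb (fun e => P (nth 0 e 0) (tl e)) ->
  cptb (fun e => bex (N e) (fun i => P i e)).
Proof.
  intros HN HP. apply cptb_negb, cptb_eqb; [|apply cpt_const].
  now apply cpt_cnt.
Qed.

Lemma cpt_bmin N (P : nat -> list nat -> bool) :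
  cpt N -> cptb (fun e => P (nth 0 e 0) (tl e)) ->
  cpt (fun e => bmin (N e) (fun i => P i e)).
Proof.
  intros HN HP.
  apply (cpt_bsum N (fun i e => Nat.b2n (negb (bex (S i) (fun j => P j e))))); auto.
  apply cptb_negb, (cptb_bex (fun e => S (nth 0 e 0)) (fun j e => P j (tl e))).
  - apply cpt_succ, cpt_proj.
  - apply (cpt_subst (fun e => nth 0 e 0 :: tl (tl e))
      (fun e => Nat.b2n (P (nth 0 e 0) (tl e)))); auto using cpt_skip1.
Qed.

Definition bitsum (n : nat) (F : nat -> bool) : nat := bsum n (fun i => Nat.b2n (F i) * 2 ^ i).

(* [2 ^ x * (2 * c + 1)] codes the list with head [x] and tail coded by [c];
   [0] behaves as the constant sequence [0]. *)
Definition seq_cons (x c : nat) : nat := 2 ^ x * (2 * c + 1).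

(** The list grows at its head, so the recursion computes the last entry first; hence the reversed
    index. *)
Definition tabulate (n : nat) (F : nat -> nat) : nat :=
  nat_rect (fun _ => nat) 0 (fun i z => seq_cons (F (n - S i)) z) n.

Lemma cpt_bitsum N (F : nat -> list nat -> bool) :
  cpt N -> cptb (fun e => F (nth 0 e 0) (tl e)) ->
  cpt (fun e => bitsum (N e) (fun i => F i e)).
Proof.
  intros HN HF. apply (cpt_bsum N (fun i e => Nat.b2n (F i e) * 2 ^ i)); auto.
  apply cpt_mul; [exact HF|]. apply cpt_pow; auto using cpt_const, cpt_proj.
Qed.

Lemma cpt_seq_cons : cpt2 seq_cons.
Proof.
  apply cpt_mul; [apply cpt_pow|apply cpt_add; [apply cpt_mul|]];
    auto using cpt_const, cpt_proj.
Qed.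

Lemma cpt_tabulate N (F : nat -> list nat -> nat) :
  cpt N -> cpt (fun e => F (nth 0 e 0) (tl e)) ->
  cpt (fun e => tabulate (N e) (fun i => F i e)).
Proof.
  intros HN HF.
  apply (cpt_nat_rect (fun _ => 0) N (fun i z e => seq_cons (F (N e - S i) e) z));
    auto using cpt_const.
  apply (cpt2_app seq_cons (fun e => F (N (tl (tl e)) - S (nth 0 e 0)) (tl (tl e))));
    auto using cpt_seq_cons, cpt_proj.
  apply (cpt_subst (fun e => N (tl (tl e)) - S (nth 0 e 0) :: tl (tl e))
    (fun e => F (nth 0 e 0) (tl e))); auto.
  intros [|i]; simpl; [|apply (cpt_var i 2)].
  apply cpt_sub; [|apply cpt_succ, cpt_proj].
  apply (cpt_tl (fun e => N (tl e))), cpt_tl, HN.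
Qed.

Ltac cpt_var_tac i :=
  first [ exact (cpt_var i 0) | exact (cpt_var i 1) | exact (cpt_var i 2)
        | exact (cpt_var i 3) | exact (cpt_var i 4) ].

Create HintDb cpt.

(** Syntax-directed: known operators are matched before the generic application of a function, whose
    own computability is looked up in the database [cpt]. *)
Ltac cpt_step :=
  match goal with
  | |- cpt (fun _ => ?c) => exact (cpt_const c)
  | |- cpt (fun e => nth ?i _ 0) => cpt_var_tac i
  | |- cptb (fun e => _ && _) => apply cptb_andb
  | |- cptb (fun e => negb _) => apply cptb_negb
  | |- cptb (fun e => implb _ _) => apply cptb_implb
  | |- cptb (fun e => _ =? _) => apply cptb_eqb
  | |- cptb (fun e => _ <? _) => apply cptb_ltb
  | |- cptb (fun e => _ <=? _) => apply cptb_leb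
  | |- cptb (fun e => ball _ _) => apply cptb_ball
  | |- cptb (fun e => bex _ _) => apply cptb_bex
  | |- cpt (fun e => cnt _ _) => apply cpt_cnt
  | |- cpt (fun e => bsum _ _) => apply cpt_bsum
  | |- cpt (fun e => bmin _ _) => apply cpt_bmin
  | |- cpt (fun e => bitsum _ _) => apply cpt_bitsum
  | |- cpt (fun e => tabulate _ _) => apply cpt_tabulate
  | |- cpt (fun e => if _ then _ else _) => apply cpt_if
  | |- cpt (fun e => S _) => apply cpt_succ
  | |- cpt (fun e => Nat.pred _) => apply cpt_pred
  | |- cpt (fun e => _ + _) => apply cpt_add
  | |- cpt (fun e => _ * _) => apply cpt_mul
  | |- cpt (fun e => _ - _) => apply cpt_sub
  | |- cpt (fun e => _ ^ _) => apply cpt_pow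
  | |- cpt (fun e => Nat.b2n (@?P e)) => change (cptb P)
  | |- cpt1 _ => solve [auto with cpt nocore]
  | |- cpt2 _ => solve [auto with cpt nocore]
  | |- cpt3 _ => solve [auto with cpt nocore]
  | |- cpt4 _ => solve [auto with cpt nocore]
  | |- cpt (fun e => ?f (@?A e) (@?B e) (@?C e) (@?E e)) => apply (cpt4_app f A B C E)
  | |- cpt (fun e => ?f (@?A e) (@?B e) (@?C e)) => apply (cpt3_app f A B C)
  | |- cpt (fun e => ?f (@?A e) (@?B e)) => apply (cpt2_app f A B)
  | |- cpt (fun e => ?f (@?A e)) => apply (cpt1_app f A)
  | |- cptb (fun e => ?f (@?A e) (@?B e) (@?C e) (@?E e)) =>
      apply (cpt4_app (fun a b c d => Nat.b2n (f a b c d)) A B C E)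
  | |- cptb (fun e => ?f (@?A e) (@?B e) (@?C e)) =>
      apply (cpt3_app (fun a b c => Nat.b2n (f a b c)) A B C)
  | |- cptb (fun e => ?f (@?A e) (@?B e)) =>
      apply (cpt2_app (fun a b => Nat.b2n (f a b)) A B)
  end.

Ltac cpt_tac := repeat (cpt_step; cbv beta).

Lemma cpt_div : cpt2 Nat.div.
Proof.
  (* Division by zero yields 0, whereas the search would fail and return its bound. *)
  apply (cpt_ext (fun e => if nth 1 e 0 =? 0 then 0 else
    bmin (S (nth 0 e 0)) (fun q => nth 0 e 0 <? nth 1 e 0 * S q))).
  - intros e. generalize (nth 0 e 0) (nth 1 e 0). intros a b.
    destruct (Nat.eqb_spec b 0) as [->|Hb]; [reflexivity|].
    assert (H := Nat.div_mod a b Hb). assert (H' := Nat.mod_upper_bound a b Hb).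
    apply bmin_unique.
    + assert (a / b <= a) by (apply Nat.Div0.div_le_upper_bound; nia). lia.
    + intros i Hi. apply Nat.ltb_ge. nia.
    + intros _. apply Nat.ltb_lt. nia.
  - cpt_tac.
Qed.
#[local] Hint Resolve cpt_div : cpt.

Lemma cpt_mod : cpt2 Nat.modulo.
Proof.
  apply (cpt_ext (fun e => nth 0 e 0 - nth 1 e 0 * (nth 0 e 0 / nth 1 e 0))).
  - intros e. generalize (nth 0 e 0) (nth 1 e 0). intros a b.
    destruct (Nat.eq_dec b 0) as [->|Hb]; [simpl; lia|].
    now rewrite Nat.Div0.mod_eq.
  - cpt_tac.
Qed.
#[local] Hint Resolve cpt_mod : cpt.

Lemma cpt_testbit : cpt2 (fun a i => Nat.b2n (Nat.testbit a i)).
Proof.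
  apply (cptb_ext (fun e => (nth 0 e 0 / 2 ^ nth 1 e 0) mod 2 =? 1)).
  - intros e. symmetry. apply Nat.testbit_eqb.
  - cpt_tac.
Qed.
#[local] Hint Resolve cpt_testbit : cpt.

Lemma cpt_sqrt : cpt1 Nat.sqrt.
Proof.
  apply (cpt_ext (fun e => bmin (S (nth 0 e 0)) (fun q => nth 0 e 0 <? S q * S q))).
  - intros e. generalize (nth 0 e 0). intros a.
    assert (H := Nat.sqrt_spec' a). cbv zeta in H.
    apply bmin_unique; [nia|intros i Hi; apply Nat.ltb_ge; nia|].
    intros _. apply Nat.ltb_lt. lia.
  - cpt_tac.
Qed.
#[local] Hint Resolve cpt_sqrt : cpt.

(** * Coding of finite sets and finite sequences by numbers *)

Lemma bitsum_lt n F : bitsum n F < 2 ^ n.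
Proof.
  induction n as [|n IH]; [simpl; lia|]. unfold bitsum in *. rewrite bsum_S.
  cbn [Nat.pow]. destruct (F n); cbn [Nat.b2n]; lia.
Qed.

Lemma testbit_add_pow x n i :
  x < 2 ^ n -> Nat.testbit (x + 2 ^ n) i = Nat.testbit x i || (i =? n).
Proof.
  intros Hx.
  rewrite Nat.add_nocarry_lxor, Nat.lxor_spec, Nat.pow2_bits_eqb, (Nat.eqb_sym n).
  - destruct (Nat.eqb_spec i n) as [->|]; [|now destruct (Nat.testbit x i)].
    now rewrite Nat.testbit_eqb, Nat.div_small.
  - apply Nat.bits_inj. intros j. rewrite Nat.land_spec, Nat.bits_0, Nat.pow2_bits_eqb.
    destruct (Nat.eqb_spec n j) as [<-|]; [|apply andb_false_r].
    now rewrite Nat.testbit_eqb, Nat.div_small.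
Qed.

Lemma testbit_bitsum n F i : Nat.testbit (bitsum n F) i = (i <? n) && F i.
Proof.
  induction n as [|n IH]; [apply Nat.bits_0|].
  unfold bitsum in *. rewrite bsum_S.
  assert (i <> n -> (i <? S n) = (i <? n)) as Hlt.
  { intros H. apply eq_true_iff_eq. rewrite !Nat.ltb_lt. lia. }
  destruct (F n) eqn:E; cbn [Nat.b2n].
  - rewrite Nat.mul_1_l, testbit_add_pow by apply bitsum_lt. rewrite IH.
    destruct (Nat.eqb_spec i n) as [->|Hn].
    + now rewrite E, orb_true_r, (proj2 (Nat.ltb_lt n (S n))) by lia.
    + now rewrite orb_false_r, Hlt.
  - rewrite Nat.mul_0_l, Nat.add_0_r, IH.
    destruct (Nat.eq_dec i n) as [->|Hn]; [|now rewrite Hlt].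
    now rewrite E, !andb_false_r.
Qed.

Lemma testbit_lt a i n : a < 2 ^ n -> Nat.testbit a i = true -> i < n.
Proof.
  intros Ha Hi. destruct (Nat.lt_ge_cases i n) as [|Hge]; [assumption|].
  assert (2 ^ n <= 2 ^ i) by (apply Nat.pow_le_mono_r; lia).
  rewrite Nat.testbit_eqb, Nat.div_small in Hi by lia. discriminate.
Qed.

Lemma pow2_gt n : n < 2 ^ n.
Proof. apply Nat.pow_gt_lin_r. lia. Qed.

Lemma testbit_inj_lt n a b :
  a < 2 ^ n -> b < 2 ^ n ->
  (forall i, i < n -> Nat.testbit a i = Nat.testbit b i) -> a = b.
Proof.
  intros Ha Hb H. apply Nat.bits_inj. intros i.
  destruct (Nat.lt_ge_cases i n) as [|Hge]; [auto|].
  destruct (Nat.testbit a i) eqn:Ea; [apply (testbit_lt a i n) in Ea; lia|].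
  destruct (Nat.testbit b i) eqn:Eb; [apply (testbit_lt b i n) in Eb; lia|reflexivity].
Qed.

(** Since [u < 2 ^ u], all bits of [u] lie at positions below [u], so [u] itself bounds the
    search. *)
Definition sub (u v : nat) : bool :=
  ball u (fun i => implb (Nat.testbit u i) (Nat.testbit v i)).

Lemma sub_spec u v :
  sub u v = true <-> forall i, Nat.testbit u i = true -> Nat.testbit v i = true.
Proof.
  unfold sub. rewrite ball_spec. split.
  - intros H i Hi. assert (i < u) as Hu.
    { destruct (Nat.lt_ge_cases i u) as [|Hge]; [assumption|].
      assert (u < 2 ^ i) as Hlt by (pose proof (pow2_gt i); lia).
      apply (testbit_lt u i i) in Hi; lia. }
    specialize (H i Hu). now rewrite Hi in H.
  - intros H i _. specialize (H i). destruct (Nat.testbit u i); simpl; auto.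
Qed.

Lemma sub_refl u : sub u u = true.
Proof. apply sub_spec. auto. Qed.

Lemma sub_trans u v x : sub u v = true -> sub v x = true -> sub u x = true.
Proof. rewrite !sub_spec. auto. Qed.

(** The head is the exponent of 2 in the code, that is, the position of the lowest set bit. *)
Definition seq_hd (c : nat) : nat := bmin c (Nat.testbit c).
Definition seq_tl (c : nat) : nat := c / 2 ^ S (seq_hd c).
Definition get (c i : nat) : nat := seq_hd (nat_rect (fun _ => nat) c (fun _ z => seq_tl z) i).

Lemma seq_hd_cons x c : seq_hd (seq_cons x c) = x.
Proof.
  unfold seq_hd, seq_cons. apply bmin_unique.
  - pose proof (pow2_gt x). nia.
  - intros i Hi. rewrite Nat.mul_comm, Nat.mul_pow2_bits_low; auto.
  - intros _. rewrite Nat.mul_comm, Nat.mul_pow2_bits_high by lia.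
    rewrite Nat.sub_diag. apply Nat.testbit_odd_0.
Qed.

Lemma seq_tl_cons x c : seq_tl (seq_cons x c) = c.
Proof.
  unfold seq_tl. rewrite seq_hd_cons. unfold seq_cons.
  symmetry. apply (Nat.div_unique _ _ c (2 ^ x)); rewrite Nat.pow_succ_r'; [|nia].
  pose proof (pow2_gt x). lia.
Qed.

Lemma get_cons_0 x c : get (seq_cons x c) 0 = x.
Proof. apply seq_hd_cons. Qed.

Lemma get_tl c i : get c (S i) = get (seq_tl c) i.
Proof.
  unfold get. f_equal. cbn [nat_rect].
  induction i as [|i IH]; [reflexivity|]. cbn [nat_rect]. now rewrite IH.
Qed.

Lemma get_cons_S x c i : get (seq_cons x c) (S i) = get c i.
Proof. now rewrite get_tl, seq_tl_cons. Qed.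

Lemma get_0 i : get 0 i = 0.
Proof. induction i as [|i IH]; [reflexivity|]. now rewrite get_tl. Qed.

Lemma get_tabulate n F j : j < n -> get (tabulate n F) j = F j.
Proof.
  unfold tabulate.
  assert (forall i j, i <= n -> j < i ->
    get (nat_rect (fun _ => nat) 0 (fun i z => seq_cons (F (n - S i)) z) i) j =
    F (n - i + j)) as H.
  { intros i. induction i as [|i IH]; intros j' Hi Hj; [lia|].
    cbn [nat_rect]. destruct j' as [|j'].
    - now rewrite get_cons_0, Nat.add_0_r.
    - rewrite get_cons_S, IH by lia. f_equal. lia. }
  intros Hj. rewrite H by lia. f_equal. lia.
Qed.

Lemma cpt_seq_hd : cpt1 seq_hd.
Proof. unfold cpt1, seq_hd. apply (cpt_bmin _ (fun i e => Nat.testbit (nth 0 e 0) i)); cpt_tac. Qed.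
#[local] Hint Resolve cpt_seq_cons cpt_seq_hd : cpt.

Lemma cpt_seq_tl : cpt1 seq_tl.
Proof. unfold cpt1, seq_tl. cpt_tac. Qed.
#[local] Hint Resolve cpt_seq_tl : cpt.

Lemma cpt_get : cpt2 get.
Proof.
  unfold cpt2, get.
  apply (cpt1_app seq_hd); [cpt_tac|].
  apply (cpt_nat_rect _ _ (fun _ z _ => seq_tl z)); cpt_tac.
Qed.

Lemma cptb_sub : cpt2 (fun u v => Nat.b2n (sub u v)).
Proof. unfold sub. apply cptb_ball; cpt_tac. Qed.
#[local] Hint Resolve cpt_get cptb_sub : cpt.


(** * Step-bounded simulation of programs *)

(* Runs [p] on the argument list [xs] of length [ar] with fuel [s] and with the bits
   of [o] at positions below [s] as oracle; the value [y] is returned as [S y], and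
   [0] means that the simulation got stuck. *)
Fixpoint sim (p : prog) (ar s o : nat) (xs : list nat) : nat :=
  match p with
  | Zero => 1
  | Succ => S (S (nth 0 xs 0))
  | Proj i => S (nth i xs 0)
  | Oracle => if nth 0 xs 0 <? s then S (Nat.b2n (Nat.testbit o (nth 0 xs 0))) else 0
  | Comp f gs =>
      let ys := map (fun g => sim g ar s o xs) gs in
      if forallb (fun y => 0 <? y) ys then sim f (length gs) s o (map Nat.pred ys) else 0
  | PrimRec f g =>
      match ar with
      | 0 => 0
      | S ar' =>
          nat_rect (fun _ => nat) (sim f ar' s o (tl xs))
            (fun n z => if z =? 0 then 0
                        else sim g (S (S ar')) s o (n :: Nat.pred z :: tl xs))
            (nth 0 xs 0)
      end
  | Mu f =>
      let n := bmin s (fun n => sim f (S ar) s o (n :: xs) <=? 1) in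
      if (n <? s) && (sim f (S ar) s o (n :: xs) =? 1) then S n else 0
  end.

Definition oracle_prefix (w : nat -> bool) (s : nat) : nat := bitsum s w.

(** For [Mu], the search in [sim] stops at the first argument whose run is stuck or returns zero,
    and succeeds only in the second case. So all earlier runs have returned positive values, and
    more fuel cannot reveal an earlier zero. *)
Lemma sim_mono p ar s o s' o' xs y :
  s <= s' -> (forall i, i < s -> Nat.testbit o i = Nat.testbit o' i) ->
  sim p ar s o xs = S y -> sim p ar s' o' xs = S y.
Proof.
  intros Hs Ho. revert ar xs y.
  induction p as [| | | |f gs IHf IHgs|f g IHf IHg|f IHf] using prog_nested_ind;
    intros ar xs y; cbn [sim]; auto.
  - destruct (Nat.ltb_spec (nth 0 xs 0) s); [|discriminate].
    rewrite (proj2 (Nat.ltb_lt _ _)) by lia. now rewrite Ho.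
  - destruct (forallb _ _) eqn:E; [|discriminate]. intros H.
    assert (map (fun g => sim g ar s' o' xs) gs = map (fun g => sim g ar s o xs) gs) as ->.
    { clear - E IHgs. induction IHgs as [|g gs Hg _ IH]; [reflexivity|]. simpl in *.
      apply andb_true_iff in E as [E1 E2]. rewrite IH by assumption. f_equal.
      destruct (sim g ar s o xs) eqn:Eg; [discriminate|]. now apply Hg. }
    rewrite E. auto.
  - destruct ar as [|ar]; [discriminate|]. revert y.
    induction (nth 0 xs 0) as [|n IH]; intros y; cbn [nat_rect]; [apply IHf|].
    destruct (nat_rect _ _ _ n) as [|z] eqn:E; [discriminate|].
    rewrite (IH z) by reflexivity. apply IHg.
  - set (P := fun n => sim f (S ar) s o (n :: xs) <=? 1).
    set (P' := fun n => sim f (S ar) s' o' (n :: xs) <=? 1).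
    destruct (bmin_spec s P) as (_ & Hlt & Hat).
    destruct (Nat.ltb_spec (bmin s P) s) as [Hn|]; [|discriminate].
    destruct (Nat.eqb_spec (sim f (S ar) s o (bmin s P :: xs)) 1) as [H1|]; [|discriminate].
    intros [= <-]. rewrite (bmin_unique s' P' (bmin s P)).
    + rewrite (proj2 (Nat.ltb_lt _ _)) by lia. now rewrite (IHf _ _ 0).
    + lia.
    + intros i Hi. specialize (Hlt i Hi). unfold P, P' in *. apply Nat.leb_gt in Hlt.
      apply Nat.leb_gt. destruct (sim f (S ar) s o (i :: xs)) eqn:E; [lia|].
      now rewrite (IHf _ _ _ E).
    + intros _. unfold P'. now rewrite (IHf _ _ 0).
Qed.

(** The hypothesis on the length rules out [PrimRec] on the empty list: [eval] has no rule for it,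
    while the default value of [nth] would let the simulation recurse on 0. *)
Lemma sim_sound w p ar s xs y :
  length xs = ar -> sim p ar s (oracle_prefix w s) xs = S y -> eval w p xs y.
Proof.
  revert ar xs y.
  induction p as [| | | |f gs IHf IHgs|f g IHf IHg|f IHf] using prog_nested_ind;
    intros ar xs y Hl; cbn [sim].
  - intros [= <-]. constructor.
  - intros [= <-]. destruct xs; constructor.
  - intros [= <-]. constructor.
  - destruct (Nat.ltb_spec (nth 0 xs 0) s) as [H|]; [|discriminate].
    unfold oracle_prefix. rewrite testbit_bitsum, (proj2 (Nat.ltb_lt _ _) H).
    intros [= <-]. replace (nth 0 xs 0) with (hd 0 xs) by now destruct xs.
    replace (Nat.b2n _) with (if w (hd 0 xs) then 1 else 0) by now destruct (w (hd 0 xs)).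
    constructor.
  - destruct (forallb _ _) eqn:E; [|discriminate]. intros H.
    apply eComp with (ys := map Nat.pred (map (fun g => sim g ar s (oracle_prefix w s) xs) gs)).
    + clear - E IHgs Hl. induction IHgs as [|g gs Hg _ IH]; simpl in *; constructor.
      * apply andb_true_iff in E as [E1 _]. apply (Hg ar); [assumption|].
        destruct (sim g ar s (oracle_prefix w s) xs); [discriminate|reflexivity].
      * apply IH. now apply andb_true_iff in E.
    + apply (IHf (length gs)); [|assumption]. now rewrite !length_map.
  - destruct ar as [|ar]; [discriminate|]. destruct xs as [|x xs]; [discriminate|].
    injection Hl as Hl. cbn [nth tl]. revert y.
    induction x as [|n IH]; intros y; cbn [nat_rect].
    + intros H. apply ePR0. now apply (IHf ar).
    + destruct (nat_rect _ _ _ n) as [|z]; [discriminate|]. intros H.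
      apply ePRS with z; [now apply IH|]. apply (IHg (S (S ar))); [simpl; lia|assumption].
  - set (P := fun n => sim f (S ar) s (oracle_prefix w s) (n :: xs) <=? 1).
    destruct (bmin_spec s P) as (_ & Hlt & _).
    destruct (Nat.ltb_spec (bmin s P) s) as [Hn|]; [|discriminate].
    destruct (Nat.eqb_spec (sim f (S ar) s (oracle_prefix w s) (bmin s P :: xs)) 1)
      as [H1|]; [|discriminate].
    intros [= <-]. constructor; [apply (IHf (S ar)); simpl; auto|].
    intros m Hm. specialize (Hlt m Hm). unfold P in Hlt. apply Nat.leb_gt in Hlt.
    destruct (sim f (S ar) s (oracle_prefix w s) (m :: xs)) as [|[|k]] eqn:E; try lia.
    exists k. apply (IHf (S ar)); simpl; auto.
Qed.

Lemma sim_prefix_mono w p ar s s' xs y :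
  s <= s' -> sim p ar s (oracle_prefix w s) xs = S y ->
  sim p ar s' (oracle_prefix w s') xs = S y.
Proof.
  intros Hs. apply sim_mono; [assumption|]. intros i Hi. unfold oracle_prefix.
  now rewrite !testbit_bitsum, !(proj2 (Nat.ltb_lt _ _)) by lia.
Qed.

Lemma sim_complete w p xs y :
  eval w p xs y -> exists s, sim p (length xs) s (oracle_prefix w s) xs = S y.
Proof.
  revert xs y.
  induction p as [| | | |f gs IHf IHgs|f g IHf IHg|f IHf] using prog_nested_ind;
    intros xs y H; cbn [sim].
  - inversion H; subst. exists 0; reflexivity.
  - inversion H; subst. exists 0. now destruct xs.
  - inversion H; subst. exists 0; reflexivity.
  - inversion H; subst. exists (S (hd 0 xs)).
    replace (nth 0 xs 0) with (hd 0 xs) by now destruct xs.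
    unfold oracle_prefix. rewrite testbit_bitsum, (proj2 (Nat.ltb_lt _ _)) by lia.
    now destruct (w (hd 0 xs)).
  - inversion H as [| | | |? ? ? ys ? Hgs Hf| | |]; subst.
    assert (length ys = length gs /\ exists s,
      map (fun g => sim g (length xs) s (oracle_prefix w s) xs) gs = map S ys)
      as (Hlen & s1 & H1).
    { clear - IHgs Hgs. revert ys Hgs.
      induction IHgs as [|g gs Hg _ IH]; intros ys Hys;
        inversion Hys as [|? ? ? y ys' Hy Hys']; subst.
      - split; [reflexivity|]. exists 0; reflexivity.
      - destruct (Hg _ _ Hy) as (sa & Ha). destruct (IH _ Hys') as (Hl & sb & Hb).
        split; [simpl; lia|]. exists (sa + sb). simpl. f_equal.
        + apply (sim_prefix_mono w g _ sa); [lia|assumption].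
        + rewrite <- Hb. clear - Hb.
          revert ys' Hb. induction gs as [|g' gs IH]; intros ys Hb; [reflexivity|].
          destruct ys as [|y' ys]; [discriminate|]. injection Hb as Hg Hb. simpl.
          rewrite Hg. f_equal; [|now apply (IH ys)].
          apply (sim_prefix_mono w g' _ sb); [lia|assumption]. }
    destruct (IHf _ _ Hf) as (s2 & H2). exists (s1 + s2).
    assert (map (fun g => sim g (length xs) (s1 + s2) (oracle_prefix w (s1 + s2)) xs) gs
            = map S ys) as ->.
    { clear - H1. revert ys H1. induction gs as [|g gs IH]; intros ys H1; [assumption|].
      destruct ys as [|y ys]; [discriminate|]. injection H1 as Hg H1. simpl.
      f_equal; [|now apply IH]. apply (sim_prefix_mono w g _ s1); [lia|assumption]. }
    assert (forallb (fun y => 0 <? y) (map S ys) = true) as ->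
      by (clear; induction ys; auto).
    rewrite map_map, map_id, <- Hlen.
    apply (sim_prefix_mono w f _ s2); [lia|assumption].
  - destruct xs as [|x xs]; [inversion H|]. cbn [length nth tl]. revert y H.
    induction x as [|n IH]; intros y H; cbn [nat_rect].
    + inversion H; subst. now apply IHf.
    + inversion H as [| | | | | |? ? ? ? z ? Hn Hg|]; subst.
      destruct (IH _ Hn) as (s1 & H1). destruct (IHg _ _ Hg) as (s2 & H2).
      exists (s1 + s2).
      pose proof (sim_prefix_mono w (PrimRec f g) (S (length xs)) s1 (s1 + s2) (n :: xs) z
        ltac:(lia) H1) as H3.
      cbn [sim nth tl] in H3. rewrite H3. cbn [Nat.eqb Nat.pred].
      apply (sim_prefix_mono w g _ s2); [lia|assumption].
  - inversion H as [| | | | | | |? ? n H0 Hlt]; subst.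
    assert (exists s, forall m, m < y -> exists k,
      sim f (S (length xs)) s (oracle_prefix w s) (m :: xs) = S (S k)) as (s1 & H1).
    { clear H H0. induction y as [|y IH]; [exists 0; lia|].
      destruct IH as (sa & Ha); [intros m Hm; apply Hlt; lia|].
      destruct (Hlt y) as (k & Hk); [lia|]. destruct (IHf _ _ Hk) as (sb & Hb).
      exists (sa + sb). intros m Hm. destruct (Nat.eq_dec m y) as [->|].
      - exists k. apply (sim_prefix_mono w f _ sb); [lia|assumption].
      - destruct (Ha m) as (k' & Hk'); [lia|]. exists k'.
        apply (sim_prefix_mono w f _ sa); [lia|assumption]. }
    destruct (IHf _ _ H0) as (s2 & H2). set (s := S y + s1 + s2). exists s.
    assert (sim f (S (length xs)) s (oracle_prefix w s) (y :: xs) = 1) as Hy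
      by (apply (sim_prefix_mono w f _ s2); [lia|assumption]).
    rewrite (bmin_unique s _ y).
    + rewrite Hy, (proj2 (Nat.ltb_lt _ _)) by lia. reflexivity.
    + lia.
    + intros i Hi. destruct (H1 i Hi) as (k & Hk). apply Nat.leb_gt.
      rewrite (sim_prefix_mono w f _ s1 s _ (S k)); [lia|lia|assumption].
    + intros _. now rewrite Hy.
Qed.

(** Both evaluations are simulated with a common amount of fuel. *)
Lemma eval_functional w p xs y y' : eval w p xs y -> eval w p xs y' -> y = y'.
Proof.
  intros H H'. apply sim_complete in H as (s & Hs), H' as (s' & Hs').
  apply (sim_prefix_mono w _ _ _ (s + s')) in Hs, Hs'; [|lia|lia]. congruence.
Qed.

(** The program is not an input: each fixed [p] gets its own simulator, by induction on [p].
    Arguments are a list of computable functions, so that those of subprograms can be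
    substituted. *)
Lemma cpt_sim p : forall ar s o Xs, cpt s -> cpt o -> Forall cpt Xs ->
  cpt (fun e => sim p ar (s e) (o e) (map (fun X => X e) Xs)).
Proof.
  assert (Hnth : forall i Xs, Forall cpt Xs -> cpt (fun e => nth i (map (fun X => X e) Xs) 0)).
  { intros i Xs H. revert i.
    induction H as [|X Xs HX _ IH]; intros [|i]; simpl; auto using cpt_const. }
  assert (Htl2 : forall A, cpt A -> cpt (fun e => A (tl (tl e)))).
  { intros A HA. apply (cpt_tl (fun e => A (tl e))), cpt_tl, HA. }
  induction p as [| | | |f gs IHf IHgs|f g IHf IHg|f IHf] using prog_nested_ind;
    intros ar s o Xs Hs Ho HX; cbn [sim].
  - apply cpt_const.
  - apply cpt_succ, cpt_succ, Hnth, HX.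
  - apply cpt_succ, Hnth, HX.
  - specialize (Hnth 0 _ HX). apply cpt_if; [now apply cptb_ltb| |apply cpt_const].
    apply cpt_succ, (cpt2_app (fun a i => Nat.b2n (Nat.testbit a i))); auto.
    exact cpt_testbit.
  - set (Gs := map (fun g e => sim g ar (s e) (o e) (map (fun X => X e) Xs)) gs).
    assert (Forall cpt Gs) as HGs
      by (apply Forall_map; apply (Forall_impl _ (fun g Hg => Hg ar s o Xs Hs Ho HX) IHgs)).
    apply (cpt_ext (fun e =>
      if forallb (fun y => 0 <? y) (map (fun G => G e) Gs)
      then sim f (length gs) (s e) (o e)
             (map (fun G => G e) (map (fun G e => Nat.pred (G e)) Gs)) else 0)).
    { intros e. unfold Gs. rewrite !map_map. reflexivity. }
    apply cpt_if; [|apply IHf; auto|apply cpt_const].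
    + clear - HGs. induction HGs as [|G Gs HG _ IH]; [exact (cpt_const 1)|].
      apply cptb_andb; [apply cptb_ltb; auto using cpt_const|exact IH].
    + apply Forall_map. revert HGs. apply Forall_impl. intros G. apply cpt_pred.
  - destruct ar as [|ar]; [apply cpt_const|].
    assert (Forall cpt (tl Xs)) as HX' by (destruct HX; simpl; auto).
    apply (cpt_ext (fun e => nat_rect (fun _ => nat)
      (sim f ar (s e) (o e) (map (fun X => X e) (tl Xs)))
      (fun n z => if z =? 0 then 0
         else sim g (S (S ar)) (s e) (o e) (n :: Nat.pred z :: map (fun X => X e) (tl Xs)))
      (nth 0 (map (fun X => X e) Xs) 0))).
    { intros e. now destruct Xs. }
    apply (cpt_nat_rect _ _ (fun n z e => if z =? 0 then 0
         else sim g (S (S ar)) (s e) (o e) (n :: Nat.pred z :: map (fun X => X e) (tl Xs))));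
      auto.
    apply cpt_if; [cpt_tac|apply cpt_const|].
    apply (cpt_ext (fun e => sim g (S (S ar)) (s (tl (tl e))) (o (tl (tl e)))
      (map (fun X => X e) ((fun e => nth 0 e 0) :: (fun e => Nat.pred (nth 1 e 0)) ::
         map (fun X e => X (tl (tl e))) (tl Xs))))).
    { intros e. cbn [map]. now rewrite map_map. }
    apply IHg; auto. repeat constructor; [cpt_tac|cpt_tac|].
    apply Forall_map. revert HX'. apply Forall_impl. exact Htl2.
  - assert (forall N, cpt N ->
      cpt (fun e => sim f (S ar) (s e) (o e) (N e :: map (fun X => X e) Xs))) as HN.
    { intros N HN. apply (IHf (S ar) s o (N :: Xs)); auto. }
    assert (cpt (fun e => bmin (s e)
      (fun n => sim f (S ar) (s e) (o e) (n :: map (fun X => X e) Xs) <=? 1))) as Hmin.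
    { apply cpt_bmin; [assumption|]. apply cptb_leb; [|apply cpt_const].
      apply (cpt_ext (fun e => sim f (S ar) (s (tl e)) (o (tl e))
        (map (fun X => X e) ((fun e => nth 0 e 0) :: map (fun X e => X (tl e)) Xs)))).
      - intros e. cbn [map]. now rewrite map_map.
      - apply IHf; auto using cpt_tl. constructor; [apply cpt_proj|].
        apply Forall_map. revert HX. apply Forall_impl. exact cpt_tl. }
    apply cpt_if; [|now apply cpt_succ|apply cpt_const].
    apply cptb_andb; [now apply cptb_ltb|].
    apply cptb_eqb; [|apply cpt_const]. now apply HN.
Qed.

(** * The token game *)

(* There are [m] tokens, the token [a] sitting on the finite set [tok a], and [n]
   equally likely random strings, the string [s] being labelled by the finite set
   [ell s]. The cone of [a] consists of the strings with label above [tok a]. *)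
Definition cone_in (n : nat) (tok ell : nat -> nat) (W : nat -> bool) (a : nat) : bool :=
  ball n (fun s => implb (sub (tok a) (ell s)) (W s)).

(** Each token claims a mass of [n / m] strings from its cone; this is Hall's condition for
    satisfying all claims disjointly, tested on sets [W] of strings instead of sets of tokens. *)
Definition hall (n m : nat) (tok ell : nat -> nat) : Prop :=
  forall W, n * cnt m (cone_in n tok ell W) <= m * cnt n W.

Definition move (tok : nat -> nat) (a v : nat) : nat -> nat :=
  fun b => if b =? a then v else tok b.

Lemma cone_in_spec n tok ell W a :
  cone_in n tok ell W a = true <->
  forall s, s < n -> sub (tok a) (ell s) = true -> W s = true.
Proof.
  unfold cone_in. rewrite ball_spec.
  split; intros H s Hs; specialize (H s Hs).
  - intros Ha. now rewrite Ha in H.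
  - destruct (sub (tok a) (ell s)); simpl; auto.
Qed.

(** Larger labels enlarge the cones, so fewer cones fit into a given [W]. *)
Lemma hall_mono_ell n m tok ell ell' :
  (forall s, s < n -> sub (ell s) (ell' s) = true) -> hall n m tok ell -> hall n m tok ell'.
Proof.
  intros He H W. eapply Nat.le_trans; [|apply H]. apply Nat.mul_le_mono_l, cnt_le.
  intros a _. rewrite !cone_in_spec. intros Ha s Hs Hsub.
  apply Ha; [assumption|]. eapply sub_trans; eauto.
Qed.

(** Moving one token changes the count for any [W] by at most one. A set violating the condition
    after the move was therefore nearly tight before, and it has gained the cone of [c]: it contains
    the new cone but not the old one. *)
Lemma tight_of_bad_move n m tok ell v c :
  hall n m tok ell -> ~ hall n m (move tok c v) ell ->
  exists W,
    m * cnt n W < n * S (cnt m (cone_in n tok ell W)) /\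
    (forall s, s < n -> sub v (ell s) = true -> W s = true) /\
    cone_in n tok ell W c = false.
Proof.
  intros H Hbad.
  assert (exists W, m * cnt n W < n * cnt m (cone_in n (move tok c v) ell W)) as (W & HW).
  { apply not_all_ex_not in Hbad as (W & HW).
    exists W. lia. }
  specialize (H W). exists W.
  assert (forall a, a <> c ->
    cone_in n (move tok c v) ell W a = cone_in n tok ell W a) as Hne.
  { intros a Ha. unfold cone_in, move. now rewrite (proj2 (Nat.eqb_neq a c)). }
  assert (cone_in n tok ell W c = false) as Hc.
  { apply not_true_iff_false. intros Hc.
    enough (cnt m (cone_in n (move tok c v) ell W) <= cnt m (cone_in n tok ell W)) by nia.
    apply cnt_le. intros a _ Ha. destruct (Nat.eq_dec a c) as [->|Hac]; [assumption|].
    now rewrite <- Hne. }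
  repeat split; [| |assumption].
  - eapply Nat.lt_le_trans; [exact HW|]. apply Nat.mul_le_mono_l, (cnt_remove _ _ _ c).
    intros a _ Hac Ha. now rewrite <- Hne.
  - assert (cone_in n (move tok c v) ell W c = true) as Hv.
    { apply not_false_iff_true. intros Hv.
      enough (cnt m (cone_in n (move tok c v) ell W) <= cnt m (cone_in n tok ell W)) by nia.
      apply cnt_le. intros a _ Ha. destruct (Nat.eq_dec a c) as [->|Hac]; [congruence|].
      now rewrite <- Hne. }
    rewrite cone_in_spec in Hv. unfold move in Hv. now rewrite Nat.eqb_refl in Hv.
Qed.

(** A new token is dropped if it lies below a chosen one; otherwise it replaces the chosen ones
    below it. Tokens at equal positions thus leave a single representative. *)
Lemma maximal_antichain (tok : nat -> nat) (l : list nat) :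
  exists l', incl l' l /\
    (forall a, In a l -> exists c, In c l' /\ sub (tok a) (tok c) = true) /\
    ForallOrdPairs (fun a b => sub (tok a) (tok b) = false /\ sub (tok b) (tok a) = false) l'.
Proof.
  induction l as [|x l (l' & Hi & Hc & Hp)].
  { exists []. repeat split; [intros ? []|intros ? []|constructor]. }
  destruct (existsb (fun c => sub (tok x) (tok c)) l') eqn:E.
  - exists l'. apply existsb_exists in E as (c & Hcl & Hxc).
    repeat split; [intros a Ha; right; auto| |assumption].
    intros a [<-|Ha]; eauto.
  - exists (x :: filter (fun c => negb (sub (tok c) (tok x))) l'). repeat split.
    + intros a [<-|Ha]; [now left|]. right. apply Hi. now apply filter_In in Ha.
    + intros a [<-|Ha]; [exists x; split; [now left|apply sub_refl]|].
      destruct (Hc a Ha) as (c & Hcl & Hac). destruct (sub (tok c) (tok x)) eqn:Ecx.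
      * exists x. split; [now left|]. eapply sub_trans; eauto.
      * exists c. split; [right; apply filter_In; now rewrite Ecx|assumption].
    + constructor.
      * apply Forall_forall. intros c Hc'. apply filter_In in Hc' as [Hcl Hcx]. split.
        -- apply not_true_iff_false. intros H. rewrite <- not_true_iff_false in E.
           apply E, existsb_exists. eauto.
        -- now apply negb_true_iff.
      * clear - Hp. induction Hp as [|a l' Ha _ IH]; simpl; [constructor|].
        destruct (negb _); [|assumption]. constructor; [|assumption].
        apply Forall_forall. intros b Hb. apply filter_In in Hb as [Hb _].
        rewrite Forall_forall in Ha. auto.
Qed.

Lemma disjoint_family_size n R (q : nat -> nat -> bool) (l : list nat) :
  ForallOrdPairs (fun a b => forall s, s < n -> q a s = true -> q b s = false) l ->
  (forall a, In a l -> n <= R * cnt n (q a)) -> 0 < n -> length l <= R.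
Proof.
  intros Hp Hq Hn.
  enough (n * length l <= R * cnt n (fun s => existsb (fun a => q a s) l)) as H.
  { pose proof (cnt_bound n (fun s => existsb (fun a => q a s) l)). nia. }
  clear Hn. induction Hp as [|a l Ha _ IH]; [simpl; lia|].
  assert (n * length l <= R * cnt n (fun s => existsb (fun b => q b s) l)) as H1
    by (apply IH; intros; apply Hq; now right).
  assert (n <= R * cnt n (q a)) as H2 by (apply Hq; now left).
  pose proof (cnt_union_inter n (q a) (fun s => existsb (fun b => q b s) l)) as H3.
  assert (cnt n (fun s => q a s && existsb (fun b => q b s) l) = 0) as H4.
  { apply cnt_0. intros s Hs. apply not_true_iff_false. intros H.
    apply andb_true_iff in H as [Has H]. apply existsb_exists in H as (b & Hb & Hbs).
    rewrite Forall_forall in Ha. rewrite (Ha b Hb s Hs Has) in Hbs. discriminate. }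
  change (n * S (length l) <= R * cnt n (fun s => q a s || existsb (fun b => q b s) l)).
  nia.
Qed.

(* Submodularity of [W |-> m * cnt n W - n * cnt m (cone_in W)]: the deficits of the
   tight sets add up when they are intersected. *)
Lemma tight_intersection n m tok ell (l : list nat) (V : nat -> bool) :
  hall n m tok ell ->
  (forall c, In c l -> exists W,
    m * cnt n W < n * S (cnt m (cone_in n tok ell W)) /\
    (forall s, s < n -> V s = true -> W s = true) /\
    cone_in n tok ell W c = false) ->
  exists X,
    m * cnt n X + length l <= n * cnt m (cone_in n tok ell X) + n * length l /\
    (forall s, s < n -> V s = true -> X s = true) /\
    (forall c, In c l -> cone_in n tok ell X c = false).
Proof.
  intros Hh. induction l as [|c l IH]; intros Hl.
  - exists (fun _ => true). repeat split; [|intros ? []].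
    (* The empty intersection is the full set of strings, with deficit zero. *)
    rewrite (cnt_ext m _ (fun _ => true)), !cnt_true; [simpl; lia|].
    intros a _. now apply cone_in_spec.
  - destruct IH as (X & HX & HVX & Hc); [intros; apply Hl; now right|].
    destruct (Hl c) as (W & HW & HVW & HcW); [now left|].
    exists (fun s => X s && W s). repeat split.
    + pose proof (Hh (fun s => X s || W s)) as HU.
      pose proof (cnt_union_inter n X W) as H1.
      pose proof (cnt_union_inter m (cone_in n tok ell X) (cone_in n tok ell W)) as H2.
      assert (cnt m (fun a => cone_in n tok ell X a || cone_in n tok ell W a) <=
              cnt m (cone_in n tok ell (fun s => X s || W s))) as H3.
      { apply cnt_le. intros a _. rewrite orb_true_iff, !cone_in_spec.
        intros [H|H] s Hs Ha; apply orb_true_iff; auto. }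
      assert (cnt m (fun a => cone_in n tok ell X a && cone_in n tok ell W a) <=
              cnt m (cone_in n tok ell (fun s => X s && W s))) as H4.
      { apply cnt_le. intros a _. rewrite andb_true_iff, !cone_in_spec.
        intros [H H'] s Hs Ha; apply andb_true_iff; auto. }
      cbn [length]. nia.
    + intros s Hs Hv. apply andb_true_iff; auto.
    + assert (forall a, cone_in n tok ell (fun s => X s && W s) a = true ->
        cone_in n tok ell X a = true /\ cone_in n tok ell W a = true) as Hand.
      { intros a. rewrite !cone_in_spec. intros H.
        split; intros s Hs Ha; specialize (H s Hs Ha); apply andb_true_iff in H; tauto. }
      intros a Ha. apply not_true_iff_false. intros H. apply Hand in H as [H H'].
      destruct Ha as [<-|Ha]; [congruence|]. rewrite Hc in H by assumption. discriminate.
Qed.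

(* With [R ^ 2] tokens Hall's condition survives some move to a set [v] carrying a
   fraction [1 / R] of the strings: the maximal positions below [v] form an antichain,
   so there are at most [R] of them; if moving any of them were bad, the intersection
   [X] of the corresponding tight sets would have deficit less than [R * n] but contain
   no cone of a token below [v], contradicting Hall's condition for [X] minus [Q]. *)
Lemma hall_move n R tok ell v Q q :
  0 < n -> 0 < R ->
  hall n (R * R) tok ell ->
  n <= R * cnt n Q -> (forall s, s < n -> Q s = true -> ell s = v) ->
  (forall a, a < R * R -> n <= R * cnt n (q a)) ->
  (forall a b, a < R * R -> b < R * R ->
     sub (tok a) (tok b) = false -> sub (tok b) (tok a) = false ->
     forall s, s < n -> q a s = true -> q b s = false) ->
  exists a, a < R * R /\ sub (tok a) v = true /\ hall n (R * R) (move tok a v) ell.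
Proof.
  intros Hn HR Hh HQ HQv Hq Hdisj.
  set (below := filter (fun a => sub (tok a) v) (seq 0 (R * R))).
  destruct (maximal_antichain tok below) as (l & Hincl & Hmax & Hanti).
  assert (forall a, In a l -> a < R * R /\ sub (tok a) v = true) as Hl.
  { intros a Ha. apply Hincl, filter_In in Ha as [Ha Hav]. apply in_seq in Ha.
    split; [lia|assumption]. }
  apply NNPP. intros Hno.
  assert (length l <= R) as Hlen.
  { apply (disjoint_family_size n R q); [|intros a Ha; apply Hq, Hl, Ha|assumption].
    clear - Hanti Hdisj Hl. induction Hanti as [|a l Ha _ IH]; constructor.
    - rewrite Forall_forall in *. intros b Hb. destruct (Ha b Hb).
      apply Hdisj; auto; apply Hl; [now left|now right].
    - apply IH. intros; apply Hl; now right. }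
  destruct (tight_intersection n (R * R) tok ell l (fun s => sub v (ell s)) Hh)
    as (X & HX & HVX & HcX).
  { intros c Hc. apply tight_of_bad_move; [assumption|].
    intros Hgood. apply Hno. exists c. destruct (Hl c Hc); auto. }
  (* No cone inside [X] meets [Q]: a token whose cone contains a string of [Q] sits below [v], hence
     below some [c] in [l], and the smaller cone of [c] would then lie inside [X] too. *)
  assert (cnt (R * R) (cone_in n tok ell X) <=
          cnt (R * R) (cone_in n tok ell (fun s => X s && negb (Q s)))) as H1.
  { apply cnt_le. intros a Ha HaX. apply cone_in_spec. intros s Hs Has.
    assert (X s = true) as HXs by (rewrite cone_in_spec in HaX; auto).
    rewrite HXs. simpl. apply negb_true_iff, not_true_iff_false. intros HQs.
    rewrite (HQv s Hs HQs) in Has.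
    destruct (Hmax a) as (c & Hc & Hac).
    { apply filter_In. split; [apply in_seq; lia|assumption]. }
    enough (cone_in n tok ell X c = true) as H by (now rewrite (HcX c Hc) in H).
    rewrite cone_in_spec in *. intros s' Hs' Hsub. apply HaX; [assumption|].
    eapply sub_trans; eauto. }
  pose proof (Hh (fun s => X s && negb (Q s))) as H2.
  pose proof (cnt_diff n X Q) as H3.
  assert (cnt n (fun s => X s && Q s) = cnt n Q) as H4.
  { apply cnt_ext. intros s Hs. destruct (Q s) eqn:E; [|apply andb_false_r].
    rewrite HVX; auto. rewrite (HQv s Hs E). apply sub_refl. }
  assert (R * n <= R * (R * cnt n Q)) by (apply Nat.mul_le_mono_l, HQ).
  assert (R * R * cnt n Q + length l <= n * length l) by nia.
  assert (n * length l <= n * R) by (apply Nat.mul_le_mono_l, Hlen).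
  (* The bound [length l <= R] alone would allow equality. The summand [length l], gained from the
     strict inequalities of the tight sets, forces [l] to be empty, and then [R * n <= 0]. *)
  assert (length l = 0) as E by nia. rewrite E in *. nia.
Qed.

Lemma cnt_double n P : cnt (2 * n) (fun s => P (s mod n)) = 2 * cnt n P.
Proof.
  replace (2 * n) with (n + n) by lia. rewrite cnt_add.
  rewrite (cnt_ext n (fun s => P (s mod n)) P), (cnt_ext n (fun i => P ((n + i) mod n)) P).
  - lia.
  - intros i Hi. f_equal. rewrite <- (Nat.mul_1_l n) at 1. rewrite Nat.add_comm.
    rewrite Nat.Div0.mod_add. now apply Nat.mod_small.
  - intros i Hi. f_equal. now apply Nat.mod_small.
Qed.

(** Strings become one bit longer and inherit their labels. A cone is then closed under flipping the
    new bit, so it lies in [W] only if the old cone lies in the set [W'] of strings with both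
    extensions in [W]. *)
Lemma hall_double n m tok ell :
  0 < n -> hall n m tok ell -> hall (2 * n) m tok (fun s => ell (s mod n)).
Proof.
  intros Hn H W. set (W' := fun s => W s && W (n + s)).
  assert (2 * cnt n W' <= cnt (2 * n) W) as H1.
  { rewrite <- cnt_double. apply cnt_le. intros s Hs. unfold W'.
    rewrite andb_true_iff. intros [Ha Hb].
    destruct (Nat.lt_ge_cases s n) as [Hlt|Hge]; [now rewrite Nat.mod_small in Ha|].
    replace s with (n + s mod n); [assumption|].
    replace s with (s - n + 1 * n) at 1 by lia.
    rewrite Nat.Div0.mod_add, Nat.mod_small; lia. }
  assert (cnt m (cone_in (2 * n) tok (fun s => ell (s mod n)) W) <=
          cnt m (cone_in n tok ell W')) as H2.
  { apply cnt_le. intros a _. rewrite !cone_in_spec. intros Ha s Hs Hsub.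
    apply andb_true_iff. split; apply Ha; try lia.
    - now rewrite Nat.mod_small.
    - rewrite Nat.add_comm, <- (Nat.mul_1_l n) at 1.
      now rewrite Nat.Div0.mod_add, Nat.mod_small. }
  specialize (H W'). nia.
Qed.

(** * The run of the tokens *)

(* The random bits are those of the number [s]; [t] bounds both the step at which [x] is
   output and the fuel of the simulation. *)
Definition outputs (M : prog) (t s x : nat) : bool :=
  bex t (fun i => sim M 1 t s [i] =? S (S x)).
Definition out_set (M : prog) (t s N : nat) : nat := bitsum N (outputs M t s).

(** The distance to the preceding square takes every value infinitely often. *)
Definition level (t : nat) : nat := t - Nat.sqrt t * Nat.sqrt t.

(* A state codes three sequences: labels and levels of strings, positions of tokens. *)
Definition ell (c s : nat) : nat := get (get c 0) s.
Definition lev (c s : nat) : nat := get (get c 1) s.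
Definition tok (c a : nat) : nat := get (get c 2) a.

(** Stage [t] treats strings of length [S t]; [s mod 2 ^ t] removes the last bit and gives the
    string whose label and level are inherited. The requested set is represented by a string [r]
    that has produced it. *)
Definition eligible (M : prog) (c t r s : nat) : bool :=
  (out_set M (S t) s (level (S t)) =? out_set M (S t) r (level (S t))) &&
  (lev c (s mod 2 ^ t) <? level (S t)).
Definition heavy (M : prog) (k c t r : nat) : bool :=
  2 ^ S t <=? 2 ^ k * cnt (2 ^ S t) (fun s => eligible M c t r s).
Definition request (M : prog) (k c t : nat) : nat :=
  bmin (2 ^ S t) (fun r => heavy M k c t r).
Definition requested (M : prog) (k c t : nat) : bool := request M k c t <? 2 ^ S t.
Definition target (M : prog) (k c t : nat) : nat :=
  out_set M (S t) (request M k c t) (level (S t)).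
Definition served (M : prog) (k c t s : nat) : bool :=
  requested M k c t && eligible M c t (request M k c t) s.

Definition new_ell (M : prog) (k c t s : nat) : nat :=
  if served M k c t s then target M k c t else ell c (s mod 2 ^ t).
Definition new_lev (M : prog) (k c t s : nat) : nat :=
  if served M k c t s then level (S t) else lev c (s mod 2 ^ t).

(** Hall's condition decided by exhaustion: a set of strings of length [t] is a number below
    [2 ^ 2 ^ t]. *)
Definition hallb (k t toks ells : nat) : bool :=
  ball (2 ^ 2 ^ t) (fun W =>
    2 ^ t * cnt (2 ^ k * 2 ^ k) (fun a =>
      ball (2 ^ t) (fun s => implb (sub (get toks a) (get ells s)) (Nat.testbit W s)))
    <=? 2 ^ k * 2 ^ k * cnt (2 ^ t) (fun s => Nat.testbit W s)).

Definition ell_code (M : prog) (k c t : nat) : nat :=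
  tabulate (2 ^ S t) (fun s => new_ell M k c t s).
Definition move_code (M : prog) (k c t a : nat) : nat :=
  tabulate (2 ^ k * 2 ^ k) (fun b => if b =? a then target M k c t else tok c b).
Definition movable (M : prog) (k c t a : nat) : bool :=
  sub (tok c a) (target M k c t) && hallb k (S t) (move_code M k c t a) (ell_code M k c t).
Definition tok_code (M : prog) (k c t : nat) : nat :=
  if requested M k c t && negb (bex (2 ^ k * 2 ^ k) (fun a => tok c a =? target M k c t))
  then move_code M k c t (bmin (2 ^ k * 2 ^ k) (fun a => movable M k c t a))
  else get c 2.

Definition step (M : prog) (k c t : nat) : nat :=
  seq_cons (ell_code M k c t)
    (seq_cons (tabulate (2 ^ S t) (fun s => new_lev M k c t s))
       (seq_cons (tok_code M k c t) 0)).
(** The initial code 0 reads as zero everywhere: all labels and positions are the empty set, all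
    levels 0. *)
Definition state (M : prog) (k t : nat) : nat :=
  nat_rect (fun _ => nat) 0 (fun t c => step M k c t) t.

(** * Computability of the run *)

Lemma cpt_outputs M : cpt3 (fun t s x => Nat.b2n (outputs M t s x)).
Proof.
  apply (cptb_bex _ (fun i e => sim M 1 (nth 0 e 0) (nth 1 e 0) [i] =? S (S (nth 2 e 0))));
    [cpt_tac|].
  apply cptb_eqb; [|cpt_tac].
  apply (cpt_sim M 1 (fun e => nth 0 (tl e) 0) (fun e => nth 1 (tl e) 0)
    [fun e => nth 0 e 0]); repeat constructor; cpt_tac.
Qed.
#[local] Hint Resolve cpt_outputs : cpt.

Lemma cpt_out_set M : cpt3 (out_set M).
Proof.
  apply (cpt_bitsum _ (fun x e => outputs M (nth 0 e 0) (nth 1 e 0) x)); [cpt_tac|].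
  apply (cpt3_app (fun t s x => Nat.b2n (outputs M t s x))); cpt_tac.
Qed.

Lemma cpt_level : cpt1 level.
Proof. unfold cpt1, level. cpt_tac. Qed.

Lemma cpt_ell : cpt2 ell.
Proof. unfold cpt2, ell. cpt_tac. Qed.

Lemma cpt_lev : cpt2 lev.
Proof. unfold cpt2, lev. cpt_tac. Qed.

Lemma cpt_tok : cpt2 tok.
Proof. unfold cpt2, tok. cpt_tac. Qed.
#[local] Hint Resolve cpt_out_set cpt_level cpt_ell cpt_lev cpt_tok : cpt.

Lemma cptb_eligible M : cpt4 (fun c t r s => Nat.b2n (eligible M c t r s)).
Proof. unfold cpt4, eligible. cpt_tac. Qed.
#[local] Hint Resolve cptb_eligible : cpt.

Lemma cptb_heavy M : cpt4 (fun k c t r => Nat.b2n (heavy M k c t r)).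
Proof. unfold cpt4, heavy. cpt_tac. Qed.
#[local] Hint Resolve cptb_heavy : cpt.

Lemma cpt_request M : cpt3 (request M).
Proof. unfold cpt3, request. cpt_tac. Qed.
#[local] Hint Resolve cpt_request : cpt.

Lemma cptb_requested M : cpt3 (fun k c t => Nat.b2n (requested M k c t)).
Proof. unfold cpt3, requested. cpt_tac. Qed.

Lemma cpt_target M : cpt3 (target M).
Proof. unfold cpt3, target. cpt_tac. Qed.
#[local] Hint Resolve cptb_requested cpt_target : cpt.

Lemma cptb_served M : cpt4 (fun k c t s => Nat.b2n (served M k c t s)).
Proof. unfold cpt4, served. cpt_tac. Qed.
#[local] Hint Resolve cptb_served : cpt.

Lemma cpt_new_ell M : cpt4 (new_ell M).
Proof. unfold cpt4, new_ell. cpt_tac. Qed.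

Lemma cpt_new_lev M : cpt4 (new_lev M).
Proof. unfold cpt4, new_lev. cpt_tac. Qed.
#[local] Hint Resolve cpt_new_ell cpt_new_lev : cpt.

Lemma cptb_hallb : cpt4 (fun k t toks ells => Nat.b2n (hallb k t toks ells)).
Proof. unfold cpt4, hallb. cpt_tac. Qed.
#[local] Hint Resolve cptb_hallb : cpt.

Lemma cpt_ell_code M : cpt3 (ell_code M).
Proof. unfold cpt3, ell_code. cpt_tac. Qed.

Lemma cpt_move_code M : cpt4 (move_code M).
Proof. unfold cpt4, move_code. cpt_tac. Qed.
#[local] Hint Resolve cpt_ell_code cpt_move_code : cpt.

Lemma cptb_movable M : cpt4 (fun k c t a => Nat.b2n (movable M k c t a)).
Proof. unfold cpt4, movable. cpt_tac. Qed.
#[local] Hint Resolve cptb_movable : cpt.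

Lemma cpt_tok_code M : cpt3 (tok_code M).
Proof. unfold cpt3, tok_code. cpt_tac. Qed.
#[local] Hint Resolve cpt_tok_code : cpt.

Lemma cpt_step_state M : cpt3 (step M).
Proof. unfold cpt3, step. cpt_tac. Qed.
#[local] Hint Resolve cpt_step_state : cpt.

Lemma cpt_state M : cpt2 (state M).
Proof.
  apply (cpt_nat_rect _ _ (fun t c e => step M (nth 0 e 0) c t)); cpt_tac.
Qed.

(** * The invariant of the run *)

Lemma pow2_pos n : 0 < 2 ^ n.
Proof. pose proof (pow2_gt n). lia. Qed.

Lemma outputs_mono M t t' s s' x :
  t <= t' -> (forall i, i < t -> Nat.testbit s i = Nat.testbit s' i) ->
  outputs M t s x = true -> outputs M t' s' x = true.
Proof.
  unfold outputs. intros Ht Hs. rewrite !bex_spec. intros (i & Hi & H).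
  exists i. split; [lia|]. apply Nat.eqb_eq in H. apply Nat.eqb_eq.
  now apply (sim_mono M 1 t s).
Qed.

Lemma testbit_out_set M t s N x :
  Nat.testbit (out_set M t s N) x = (x <? N) && outputs M t s x.
Proof. apply testbit_bitsum. Qed.

Lemma out_set_mono M t t' s s' N N' :
  t <= t' -> N <= N' -> (forall i, i < t -> Nat.testbit s i = Nat.testbit s' i) ->
  sub (out_set M t s N) (out_set M t' s' N') = true.
Proof.
  intros Ht HN Hs. apply sub_spec. intros x. rewrite !testbit_out_set, !andb_true_iff.
  rewrite !Nat.ltb_lt. intros [H1 H2]. split; [lia|]. now apply (outputs_mono M t t' s).
Qed.

Lemma testbit_mod_pow2 s t i : i < t -> Nat.testbit (s mod 2 ^ t) i = Nat.testbit s i.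
Proof. apply Nat.mod_pow2_bits_low. Qed.

Lemma hallb_spec k t toks ells :
  hallb k t toks ells = true <-> hall (2 ^ t) (2 ^ k * 2 ^ k) (get toks) (get ells).
Proof.
  unfold hallb. rewrite ball_spec. split.
  - intros H W. specialize (H (bitsum (2 ^ t) W) (bitsum_lt _ _)).
    apply Nat.leb_le in H.
    assert (forall s, s < 2 ^ t -> Nat.testbit (bitsum (2 ^ t) W) s = W s) as HW.
    { intros s Hs. rewrite testbit_bitsum. now rewrite (proj2 (Nat.ltb_lt _ _) Hs). }
    rewrite (cnt_ext (2 ^ t) (fun s => Nat.testbit (bitsum (2 ^ t) W) s) W HW) in H.
    eapply Nat.le_trans; [|exact H]. apply Nat.mul_le_mono_l, cnt_le.
    intros a _. rewrite cone_in_spec, ball_spec. intros Ha s Hs.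
    rewrite HW by assumption. destruct (sub (get toks a) (get ells s)) eqn:E; [|reflexivity].
    simpl. auto.
  - intros H W _. apply Nat.leb_le. apply (H (Nat.testbit W)).
Qed.

Lemma ell_step M k c t s : s < 2 ^ S t -> ell (step M k c t) s = new_ell M k c t s.
Proof.
  intros Hs. unfold ell, step. rewrite get_cons_0. unfold ell_code.
  now rewrite get_tabulate.
Qed.

Lemma lev_step M k c t s : s < 2 ^ S t -> lev (step M k c t) s = new_lev M k c t s.
Proof.
  intros Hs. unfold lev, step. rewrite get_cons_S, get_cons_0. now rewrite get_tabulate.
Qed.

Lemma tok_step M k c t a : tok (step M k c t) a = get (tok_code M k c t) a.
Proof. unfold tok, step. now rewrite !get_cons_S, get_cons_0. Qed.

(** [inv_label] makes labels grow when they are replaced at a higher level. In [inv_origin], [q a]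
    will consist of the extensions of the strings served when token [a] arrived at its position, and
    of all strings if it has never moved; disjointness bounds antichains of tokens by [2 ^ k], as
    [hall_move] requires. *)
Record invariant (M : prog) (k t c : nat) : Prop := {
  inv_label : forall s, s < 2 ^ t -> sub (ell c s) (out_set M t s (lev c s)) = true;
  inv_hall : hall (2 ^ t) (2 ^ k * 2 ^ k) (tok c) (ell c);
  inv_origin : exists q : nat -> nat -> bool,
    (forall a, a < 2 ^ k * 2 ^ k -> 2 ^ t <= 2 ^ k * cnt (2 ^ t) (q a)) /\
    (forall a s, a < 2 ^ k * 2 ^ k -> s < 2 ^ t -> q a s = true ->
       sub (tok c a) (ell c s) = true) /\
    (forall a b, a < 2 ^ k * 2 ^ k -> b < 2 ^ k * 2 ^ k ->
       sub (tok c a) (tok c b) = false -> sub (tok c b) (tok c a) = false ->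
       forall s, s < 2 ^ t -> q a s = true -> q b s = false) }.

Lemma ell_0 s : ell 0 s = 0.
Proof. unfold ell. now rewrite !get_0. Qed.

Lemma tok_0 a : tok 0 a = 0.
Proof. unfold tok. now rewrite !get_0. Qed.

Lemma invariant_0 M k : invariant M k 0 0.
Proof.
  split.
  - intros s _. now rewrite ell_0.
  - intros W. change (2 ^ 0) with 1. rewrite cnt_S. change (cnt 0 W) with 0.
    destruct (W 0) eqn:E; cbn [Nat.b2n Nat.add].
    + rewrite Nat.mul_1_l, Nat.mul_1_r. apply cnt_bound.
    + rewrite (proj2 (cnt_0 _ _)); [lia|]. intros a _. apply not_true_iff_false.
      rewrite cone_in_spec. intros H. rewrite H in E; [discriminate|lia|].
      now rewrite ell_0, tok_0.
  - exists (fun _ _ => true). repeat split.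
    + intros a _. rewrite cnt_true. change (2 ^ 0) with 1. pose proof (pow2_pos k). lia.
    + intros a s _ _ _. now rewrite ell_0, tok_0.
    + intros a b _ _ H. rewrite !tok_0 in H. discriminate.
Qed.

Lemma served_target M k c t s :
  served M k c t s = true ->
  target M k c t = out_set M (S t) s (level (S t)) /\ lev c (s mod 2 ^ t) < level (S t).
Proof.
  unfold served, eligible, target. intros H.
  apply andb_true_iff in H as [_ H]. apply andb_true_iff in H as [H1 H2].
  apply Nat.eqb_eq in H1. apply Nat.ltb_lt in H2. auto.
Qed.

Lemma served_heavy M k c t :
  requested M k c t = true ->
  2 ^ S t <= 2 ^ k * cnt (2 ^ S t) (fun s => served M k c t s).
Proof.
  intros H. unfold served. rewrite H. unfold requested in H. apply Nat.ltb_lt in H.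
  destruct (bmin_spec (2 ^ S t) (fun r => heavy M k c t r)) as (_ & _ & Hr).
  apply Nat.leb_le. exact (Hr H).
Qed.

Section Step.
Variables (M : prog) (k t c : nat).
Hypothesis Hinv : invariant M k t c.
Let m := 2 ^ k * 2 ^ k.
Let n := 2 ^ S t.

Lemma old_label_sub s :
  s < n -> sub (ell c (s mod 2 ^ t)) (out_set M (S t) s (lev c (s mod 2 ^ t))) = true.
Proof.
  intros Hs. eapply sub_trans.
  - apply (inv_label _ _ _ _ Hinv). apply Nat.mod_upper_bound. pose proof (pow2_pos t). lia.
  - apply out_set_mono; [lia|lia|]. intros i. apply testbit_mod_pow2.
Qed.

(** A string is served only above its current level, with a set it has produced by now; this set
    includes what it had produced below the old level. *)
Lemma old_label_new s : s < n -> sub (ell c (s mod 2 ^ t)) (new_ell M k c t s) = true.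
Proof.
  intros Hs. unfold new_ell. destruct (served M k c t s) eqn:E; [|apply sub_refl].
  apply served_target in E as [-> Hlt]. eapply sub_trans; [now apply old_label_sub|].
  apply out_set_mono; auto; lia.
Qed.

Lemma new_hall : hall n m (tok c) (new_ell M k c t).
Proof.
  apply (hall_mono_ell n m _ (fun s => ell c (s mod 2 ^ t))); [exact old_label_new|].
  apply (hall_double (2 ^ t)); [apply pow2_pos|]. apply (inv_hall _ _ _ _ Hinv).
Qed.

Lemma new_origin : exists q : nat -> nat -> bool,
  (forall a, a < m -> n <= 2 ^ k * cnt n (q a)) /\
  (forall a s, a < m -> s < n -> q a s = true ->
     sub (tok c a) (new_ell M k c t s) = true) /\
  (forall a b, a < m -> b < m ->
     sub (tok c a) (tok c b) = false -> sub (tok c b) (tok c a) = false ->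
     forall s, s < n -> q a s = true -> q b s = false).
Proof.
  destruct (inv_origin _ _ _ _ Hinv) as (q & H1 & H2 & H3).
  assert (forall s, s mod 2 ^ t < 2 ^ t) as Hmod
    by (intros s; apply Nat.mod_upper_bound; pose proof (pow2_pos t); lia).
  exists (fun a s => q a (s mod 2 ^ t)). repeat split.
  - intros a Ha. unfold n. rewrite Nat.pow_succ_r', cnt_double.
    specialize (H1 a Ha). lia.
  - intros a s Ha Hs Hq. eapply sub_trans; [apply (H2 a (s mod 2 ^ t)); auto|].
    now apply old_label_new.
  - intros a b Ha Hb Hab Hba s Hs. now apply H3.
Qed.

Lemma movable_spec a :
  movable M k c t a = true <->
  sub (tok c a) (target M k c t) = true /\
  hall n m (move (tok c) a (target M k c t)) (new_ell M k c t).
Proof.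
  unfold movable. rewrite andb_true_iff, hallb_spec.
  enough (hall n m (get (move_code M k c t a)) (get (ell_code M k c t)) <->
          hall n m (move (tok c) a (target M k c t)) (new_ell M k c t)) as H by tauto.
  unfold hall.
  enough (forall W, cnt m (cone_in n (get (move_code M k c t a)) (get (ell_code M k c t)) W) =
                    cnt m (cone_in n (move (tok c) a (target M k c t)) (new_ell M k c t) W))
    as H by (split; intros K W; specialize (K W); rewrite H in *; assumption).
  intros W. apply cnt_ext. intros b Hb. apply eq_true_iff_eq. rewrite !cone_in_spec.
  unfold move_code, ell_code. rewrite get_tabulate by assumption.
  split; intros K s Hs; specialize (K s Hs); rewrite get_tabulate in * by assumption; exact K.
Qed.

Lemma movable_exists :
  requested M k c t = true -> exists a, a < m /\ movable M k c t a = true.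
Proof.
  intros Hreq. destruct new_origin as (q & H1 & H2 & H3).
  destruct (hall_move n (2 ^ k) (tok c) (new_ell M k c t) (target M k c t)
    (fun s => served M k c t s) q) as (a & Ha & Hsub & Hh); auto using new_hall.
  - apply (pow2_pos (S t)).
  - apply pow2_pos.
  - now apply served_heavy.
  - intros s _ Hs. unfold new_ell. now rewrite Hs.
  - exists a. split; [assumption|]. now apply movable_spec.
Qed.

Lemma tok_step_cases :
  ((forall a, tok (step M k c t) a = tok c a) /\
   (requested M k c t = true -> exists a, a < m /\ tok c a = target M k c t)) \/
  exists a, a < m /\ requested M k c t = true /\ movable M k c t a = true /\
    forall b, b < m -> tok (step M k c t) b = move (tok c) a (target M k c t) b.
Proof.
  destruct (requested M k c t && negb (bex m (fun a => tok c a =? target M k c t))) eqn:E.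
  - right. pose proof E as E'. apply andb_true_iff in E' as [Hreq _].
    pose proof (bmin_found m (fun a => movable M k c t a) (movable_exists Hreq)) as Hlt.
    exists (bmin m (fun a => movable M k c t a)). repeat split; try assumption.
    + apply (bmin_spec m (fun a => movable M k c t a)), Hlt.
    + intros b Hb. rewrite tok_step. unfold tok_code. fold m. rewrite E.
      unfold move_code. now rewrite get_tabulate.
  - left. split.
    + intros a. rewrite tok_step. unfold tok_code. fold m. now rewrite E.
    + intros Hreq. rewrite Hreq in E. simpl in E. apply negb_false_iff, bex_spec in E.
      destruct E as (a & Ha & Heq). apply Nat.eqb_eq in Heq. eauto.
Qed.

Lemma tok_step_sub a : a < m -> sub (tok c a) (tok (step M k c t) a) = true.
Proof.
  intros Ha. destruct tok_step_cases as [[H _]|(a' & _ & _ & Hmov & H)].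
  - rewrite H. apply sub_refl.
  - rewrite H by assumption. unfold move. destruct (Nat.eqb_spec a a') as [->|].
    + now apply movable_spec in Hmov.
    + apply sub_refl.
Qed.

Lemma target_reached :
  requested M k c t = true -> exists a, a < m /\ tok (step M k c t) a = target M k c t.
Proof.
  intros Hreq. destruct tok_step_cases as [[H H']|(a & Ha & _ & _ & H)].
  - destruct (H' Hreq) as (a & Ha & Heq). exists a. now rewrite H.
  - exists a. split; [assumption|]. rewrite H by assumption. unfold move.
    now rewrite Nat.eqb_refl.
Qed.

Lemma hall_ext tk tk' el el' :
  (forall a, a < m -> tk a = tk' a) -> (forall s, s < n -> el s = el' s) ->
  hall n m tk el -> hall n m tk' el'.
Proof.
  intros Ht He H W. eapply Nat.le_trans; [|apply H]. apply Nat.mul_le_mono_l, cnt_le.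
  intros a Ha. rewrite !cone_in_spec. intros K s Hs Hsub.
  apply K; [assumption|]. now rewrite <- Ht, <- He.
Qed.

Lemma invariant_step : invariant M k (S t) (step M k c t).
Proof.
  destruct new_origin as (q & H1 & H2 & H3). split; fold m; fold n.
  - intros s Hs. rewrite ell_step, lev_step by assumption. unfold new_ell, new_lev.
    destruct (served M k c t s) eqn:E; [|now apply old_label_sub].
    apply served_target in E as [-> _]. apply sub_refl.
  - assert (forall s, s < n -> new_ell M k c t s = ell (step M k c t) s) as He
      by (intros; now rewrite ell_step).
    destruct tok_step_cases as [[H _]|(a & Ha & _ & Hmov & H)].
    + apply (hall_ext (tok c) _ (new_ell M k c t)); auto using new_hall.
    + apply (hall_ext (move (tok c) a (target M k c t)) _ (new_ell M k c t)); auto.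
      * intros; now rewrite H.
      * now apply movable_spec.
  - destruct tok_step_cases as [[H _]|(a & Ha & Hreq & Hmov & H)].
    { exists q. repeat split; auto.
      - intros a s Ha Hs. rewrite H, ell_step by assumption. now apply H2.
      - intros a b Ha Hb. rewrite !H. now apply H3. }
    exists (fun b s => if b =? a then served M k c t s else q b s).
    assert (forall s, served M k c t s = true -> new_ell M k c t s = target M k c t) as Hsv
      by (intros s Hs; unfold new_ell; now rewrite Hs).
    repeat split.
    + intros b Hb. destruct (Nat.eqb_spec b a) as [->|]; [now apply served_heavy|auto].
    + intros b s Hb Hs. rewrite H, ell_step by assumption. unfold move.
      destruct (Nat.eqb_spec b a) as [->|]; [|now apply H2].
      intros Hq. rewrite Hsv by assumption. apply sub_refl.
    (* A served string is now labelled by the target, so every token [b] with this string in [q b]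
       sits below the target and is comparable with the moved token. *)
    + assert (forall b s, b < m -> s < n -> sub (tok c b) (target M k c t) = false ->
        served M k c t s = true -> q b s = false) as Hdis.
      { intros b s Hb Hs Hsub Hsrv. apply not_true_iff_false. intros Hq.
        apply H2 in Hq; [|assumption|assumption]. rewrite Hsv in Hq by assumption.
        congruence. }
      intros b b' Hb Hb' Hbb Hb'b s Hs. rewrite !H in Hbb, Hb'b by assumption.
      unfold move in Hbb, Hb'b.
      destruct (Nat.eqb_spec b a) as [->|Hba], (Nat.eqb_spec b' a) as [->|Hb'a].
      * rewrite sub_refl in Hbb. discriminate.
      * intros Hsrv. now apply (Hdis b').
      * intros Hq. apply not_true_iff_false. intros Hsrv.
        rewrite (Hdis b) in Hq; auto. discriminate.
      * now apply H3.
Qed.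

End Step.

Lemma invariant_state M k t : invariant M k t (state M k t).
Proof. induction t as [|t IH]; [apply invariant_0|now apply invariant_step]. Qed.

(** * Infinite random sequences and limits of tokens *)

Lemma prefix_lt w t : oracle_prefix w t < 2 ^ t.
Proof. apply bitsum_lt. Qed.

Lemma testbit_prefix w t i : i < t -> Nat.testbit (oracle_prefix w t) i = w i.
Proof.
  intros Hi. unfold oracle_prefix. rewrite testbit_bitsum.
  now rewrite (proj2 (Nat.ltb_lt _ _) Hi).
Qed.

Lemma prefix_mod w t t' : t <= t' -> oracle_prefix w t' mod 2 ^ t = oracle_prefix w t.
Proof.
  intros Ht. apply (testbit_inj_lt t).
  - apply Nat.mod_upper_bound. pose proof (pow2_pos t). lia.
  - apply prefix_lt.
  - intros i Hi. rewrite testbit_mod_pow2, !testbit_prefix; auto; lia.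
Qed.

Definition enumerated (M : prog) (w : nat -> bool) (x : nat) : Prop :=
  exists t, outputs M t (oracle_prefix w t) x = true.

Lemma outputs_prefix_mono M w t t' x :
  t <= t' -> outputs M t (oracle_prefix w t) x = true ->
  outputs M t' (oracle_prefix w t') x = true.
Proof.
  intros Ht. apply outputs_mono; [assumption|].
  intros i Hi. rewrite !testbit_prefix; auto; lia.
Qed.

Lemma enumerated_spec M w x : enumerated M w x <-> exists t, eval w M [t] (S x).
Proof.
  unfold enumerated, outputs. split.
  - intros (t & H). apply bex_spec in H as (i & _ & H). apply Nat.eqb_eq in H.
    exists i. now apply (sim_sound w M 1 t).
  - intros (i & H). apply sim_complete in H as (t & H). exists (S i + t).
    apply bex_spec. exists i. split; [lia|]. apply Nat.eqb_eq.
    apply (sim_prefix_mono w M 1 t); [lia|assumption].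
Qed.

Lemma prob_enumerates_spec M w A :
  prob_enumerates M w A <-> forall x, A x <-> enumerated M w x.
Proof.
  unfold prob_enumerates. split; intros H x; rewrite H, enumerated_spec; tauto.
Qed.

Definition served_at (M : prog) (k : nat) (w : nat -> bool) (t : nat) : Prop :=
  served M k (state M k t) t (oracle_prefix w (S t)) = true.
Definition lev_at (M : prog) (k : nat) (w : nat -> bool) (t : nat) : nat :=
  lev (state M k t) (oracle_prefix w t).

Lemma lev_at_served M k w t :
  served_at M k w t ->
  lev_at M k w (S t) = level (S t) /\ lev_at M k w t < level (S t) /\
  target M k (state M k t) t = out_set M (S t) (oracle_prefix w (S t)) (level (S t)).
Proof.
  intros H. pose proof H as H'. apply served_target in H' as [Ht Hl].
  rewrite prefix_mod in Hl by lia. repeat split; auto.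
  unfold lev_at. change (state M k (S t)) with (step M k (state M k t) t).
  rewrite lev_step by apply prefix_lt. unfold new_lev. now rewrite H.
Qed.

Lemma lev_at_not_served M k w t :
  ~ served_at M k w t -> lev_at M k w (S t) = lev_at M k w t.
Proof.
  unfold lev_at. change (state M k (S t)) with (step M k (state M k t) t).
  intros H. rewrite lev_step by apply prefix_lt. unfold new_lev.
  rewrite (not_true_is_false _ H). now rewrite prefix_mod by lia.
Qed.

Lemma lev_at_S M k w t : lev_at M k w t <= lev_at M k w (S t).
Proof.
  destruct (classic (served_at M k w t)) as [H|H].
  - pose proof (lev_at_served M k w t H). lia.
  - now rewrite (lev_at_not_served M k w t H).
Qed.

Lemma lev_at_mono M k w t t' : t <= t' -> lev_at M k w t <= lev_at M k w t'.
Proof. induction 1; [lia|]. pose proof (lev_at_S M k w m). lia. Qed.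

Lemma lev_at_unbounded M k w :
  (forall T, exists t, T <= t /\ served_at M k w t) ->
  forall N, exists t, N <= lev_at M k w t.
Proof.
  intros H N. induction N as [|N (t & Ht)]; [exists 0; lia|].
  destruct (H t) as (t' & Htt & Hs). exists (S t').
  pose proof (lev_at_served M k w t' Hs). pose proof (lev_at_mono M k w t t' Htt). lia.
Qed.

Lemma infinite_pigeonhole (P : nat -> nat -> Prop) m :
  (forall T, exists t, T <= t /\ exists a, a < m /\ P a t) ->
  exists a, a < m /\ forall T, exists t, T <= t /\ P a t.
Proof.
  induction m as [|m IH]; intros H.
  - destruct (H 0) as (t & _ & a & Ha & _). lia.
  - destruct (classic (forall T, exists t, T <= t /\ P m t)) as [Hm|Hm]; [exists m; auto|].
    apply not_all_ex_not in Hm as (T0 & HT0).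
    destruct IH as (a & Ha & Hinf); [|exists a; auto].
    intros T. destruct (H (T + T0)) as (t & Ht & a & Ha & Hp).
    exists t. split; [lia|]. exists a. split; [|assumption].
    destruct (Nat.eq_dec a m) as [->|]; [|lia].
    exfalso. apply HT0. exists t. split; [lia|assumption].
Qed.

Lemma tok_mono M k t t' a :
  a < 2 ^ k * 2 ^ k -> t <= t' -> sub (tok (state M k t) a) (tok (state M k t') a) = true.
Proof.
  intros Ha. induction 1 as [|t' _ IH]; [apply sub_refl|].
  eapply sub_trans; [exact IH|]. apply tok_step_sub; [apply invariant_state|assumption].
Qed.

(** By pigeonhole, one token sits at the target after infinitely many of the stages serving [w].
    These targets are what [w] has produced below levels tending to infinity; as positions only
    grow, their union is the set enumerated by [w]. *)
Lemma token_limit M k w :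
  (forall T, exists t, T <= t /\ served_at M k w t) ->
  exists a, a < 2 ^ k * 2 ^ k /\ forall x,
    (exists t, Nat.testbit (tok (state M k t) a) x = true) <-> enumerated M w x.
Proof.
  intros H.
  destruct (infinite_pigeonhole (fun a t => served_at M k w t /\
    tok (state M k (S t)) a = target M k (state M k t) t) (2 ^ k * 2 ^ k))
    as (a & Ha & Hinf).
  { intros T. destruct (H T) as (t & Ht & Hs). exists t. split; [assumption|].
    pose proof Hs as Hreq. apply andb_true_iff in Hreq as [Hreq _].
    destruct (target_reached M k t _ (invariant_state M k t) Hreq) as (a & Ha & Heq). eauto. }
  exists a. split; [assumption|]. intros x. split.
  - intros (t & Hx). destruct (Hinf t) as (t' & Ht' & Hs & Heq).
    assert (sub (tok (state M k t) a) (tok (state M k (S t')) a) = true) as Hsub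
      by (apply tok_mono; auto).
    rewrite sub_spec in Hsub. specialize (Hsub x Hx).
    rewrite Heq, (proj2 (proj2 (lev_at_served M k w t' Hs))), testbit_out_set in Hsub.
    apply andb_true_iff in Hsub. exists (S t'). tauto.
  - intros (t & Hx). destruct (lev_at_unbounded M k w H (S x)) as (t1 & Ht1).
    destruct (Hinf (t + t1)) as (t' & Ht' & Hs & Heq). exists (S t').
    destruct (lev_at_served M k w t' Hs) as (_ & Hlt & Htar).
    rewrite Heq, Htar, testbit_out_set. apply andb_true_iff. split.
    + apply Nat.ltb_lt. pose proof (lev_at_mono M k w t1 t'). lia.
    + apply (outputs_prefix_mono M w t); [lia|assumption].
Qed.

(** * Requests of a fixed level *)

Lemma level_recurrent N T : exists t, T <= t /\ level (S t) = N.
Proof.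
  (* As [q > N], the square preceding [q * q + N] is [q * q]; the [- 1] compensates for
     [level (S t)]. *)
  set (q := S (N + T)). exists (q * q + N - 1). split; [nia|].
  replace (S (q * q + N - 1)) with (q * q + N) by nia.
  unfold level. rewrite (Nat.sqrt_unique _ q); nia.
Qed.

(* The string [s] could take part in a request of level [N] for the set [V]. *)
Definition pending (M : prog) (k N V t s : nat) : bool :=
  (out_set M (S t) s N =? V) && (lev (state M k t) (s mod 2 ^ t) <? N).

Definition below_level (M : prog) (k N t : nat) : nat :=
  cnt (2 ^ t) (fun s => lev (state M k t) s <? N).

(** Levels never decrease, so the fraction of strings below [N] cannot grow; the factor 2 only
    accounts for the longer strings. A request of level [N] lifts a fraction of at least [2 ^ - k],
    all from below [N], to [N]. *)
Lemma below_level_S M k N t :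
  below_level M k N (S t) <= 2 * below_level M k N t /\
  (requested M k (state M k t) t = true -> level (S t) = N ->
   2 ^ k * below_level M k N (S t) + 2 ^ S t <= 2 ^ k * (2 * below_level M k N t)).
Proof.
  unfold below_level. rewrite <- cnt_double, <- Nat.pow_succ_r'.
  set (c := state M k t). change (state M k (S t)) with (step M k c t).
  set (P := fun s => lev (step M k c t) s <? N).
  set (P' := fun s => lev c (s mod 2 ^ t) <? N).
  assert (forall s, s < 2 ^ S t -> P s = true ->
    P' s = true /\ (level (S t) = N -> served M k c t s = false)) as HP.
  { unfold P, P'. intros s Hs. rewrite lev_step by assumption. unfold new_lev.
    destruct (served M k c t s) eqn:E; rewrite !Nat.ltb_lt; [|tauto].
    apply served_target in E as [_ E]. lia. }
  split; [apply cnt_le; intros s Hs H; now apply HP|]. intros Hreq Hlev.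
  apply served_heavy in Hreq.
  pose proof (cnt_diff (2 ^ S t) P' (fun s => served M k c t s)) as H1.
  rewrite (cnt_ext _ (fun s => P' s && served M k c t s) (fun s => served M k c t s)) in H1.
  - assert (cnt (2 ^ S t) P <= cnt (2 ^ S t) (fun s => P' s && negb (served M k c t s))) as H2.
    { apply cnt_le. intros s Hs H. destruct (HP s Hs H) as [H' H''].
      now rewrite H', H''. }
    nia.
  - intros s _. destruct (served M k c t s) eqn:E; [|apply andb_false_r].
    rewrite andb_true_r. unfold P'. apply Nat.ltb_lt.
    apply served_target in E as [_ E]. lia.
Qed.

Lemma below_level_mono M k N t d :
  below_level M k N (t + d) <= 2 ^ d * below_level M k N t.
Proof.
  induction d as [|d IH].
  - rewrite Nat.add_0_r, Nat.pow_0_r. lia.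
  - rewrite Nat.add_succ_r, Nat.pow_succ_r'.
    pose proof (proj1 (below_level_S M k N (t + d))). lia.
Qed.

(* Every request of level [N] removes a fraction [2 ^ - k] of the strings from those
   of level below [N], so that there are at most [2 ^ k] such requests. *)
Lemma requests_finite M k N :
  ~ forall T, exists t, T <= t /\ level (S t) = N /\ requested M k (state M k t) t = true.
Proof.
  intros H.
  (* After [j] requests the fraction below [N] is at most [1 - j / 2 ^ k], which is absurd for
     [j = S (2 ^ k)]. *)
  assert (forall j, exists t, 2 ^ k * below_level M k N t + j * 2 ^ t <= 2 ^ k * 2 ^ t) as Hj.
  { induction j as [|j (t & IH)].
    - exists 0. unfold below_level.
      pose proof (cnt_bound (2 ^ 0) (fun s => lev (state M k 0) s <? N)). nia.
    - destruct (H t) as (t' & Ht & Hlev & Hreq). exists (S t').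
      pose proof (proj2 (below_level_S M k N t') Hreq Hlev) as H1.
      replace t' with (t + (t' - t)) in H1 at 3 by lia.
      pose proof (below_level_mono M k N t (t' - t)) as H2.
      assert (2 ^ S t' = 2 * (2 ^ (t' - t) * 2 ^ t)) as Hp.
      { rewrite Nat.pow_succ_r', <- Nat.pow_add_r. do 2 f_equal. lia. }
      set (B := below_level M k N t) in *. set (B' := below_level M k N (t + (t' - t))) in *.
      set (P := 2 ^ (t' - t)) in *.
      assert (2 ^ k * (2 * B') <= 2 ^ k * (2 * (P * B))) by (apply Nat.mul_le_mono_l; lia).
      assert (2 * P * (2 ^ k * B + j * 2 ^ t) <= 2 * P * (2 ^ k * 2 ^ t))
        by (apply Nat.mul_le_mono_l, IH).
      rewrite Hp in *. lia. }
  destruct (Hj (S (2 ^ k))) as (t & Ht). pose proof (pow2_pos t). nia.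
Qed.

(** Otherwise, at every late stage of level [N], any pending string is heavy and causes a request,
    possibly for another set; this contradicts [requests_finite]. *)
Lemma pending_light M k N V T :
  exists t, T <= t /\ 2 ^ k * cnt (2 ^ S t) (fun s => pending M k N V t s) < 2 ^ S t.
Proof.
  apply NNPP. intros Hno. apply (requests_finite M k N). intros T'.
  destruct (level_recurrent N (T + T')) as (t & Ht & Hlev).
  exists t. repeat split; [lia|assumption|].
  set (c := state M k t). set (G := fun s => pending M k N V t s).
  assert (2 ^ S t <= 2 ^ k * cnt (2 ^ S t) G) as Hbig.
  { apply Nat.nlt_ge. intros Hlt. apply Hno. exists t. split; [lia|exact Hlt]. }
  assert (exists r, r < 2 ^ S t /\ G r = true) as (r & Hr & HGr).
  { apply bex_spec. unfold bex. apply negb_true_iff, Nat.eqb_neq.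
    intros E. rewrite E in Hbig. pose proof (pow2_pos (S t)). lia. }
  unfold requested. apply Nat.ltb_lt, bmin_found. exists r. split; [assumption|].
  unfold heavy. apply Nat.leb_le.
  rewrite (cnt_ext _ (fun s => eligible M c t r s) G); [assumption|].
  intros s _. unfold eligible, G, pending in *. rewrite Hlev.
  apply andb_true_iff in HGr as [HGr _]. apply Nat.eqb_eq in HGr. now rewrite HGr.
Qed.

(** Only finitely many elements lie below [N], so all those of [A] have appeared by some stage. *)
Lemma pending_eventually M k w A N V :
  (forall x, A x <-> enumerated M w x) ->
  (forall x, Nat.testbit V x = true <-> x < N /\ A x) ->
  (forall t, lev_at M k w t < N) ->
  exists T, forall t, T <= t -> pending M k N V t (oracle_prefix w (S t)) = true.
Proof.
  intros HA HV Hlev.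
  assert (forall n, exists T, forall x, x < n -> A x ->
    outputs M T (oracle_prefix w T) x = true) as HT.
  { induction n as [|n (T & IH)]; [exists 0; lia|].
    destruct (classic (A n)) as [Hn|Hn].
    - apply HA in Hn as (T' & HT'). exists (T + T'). intros x Hx HAx.
      destruct (Nat.eq_dec x n) as [->|].
      + apply (outputs_prefix_mono M w T'); [lia|assumption].
      + apply (outputs_prefix_mono M w T); [lia|]. apply IH; [lia|assumption].
    - exists T. intros x Hx HAx. apply IH; [|assumption].
      destruct (Nat.eq_dec x n) as [->|]; [contradiction|lia]. }
  destruct (HT N) as (T & HTN). exists T. intros t Ht.
  unfold pending. apply andb_true_iff. split.
  - apply Nat.eqb_eq, Nat.bits_inj. intros x. apply eq_true_iff_eq.
    rewrite HV, testbit_out_set, andb_true_iff, Nat.ltb_lt. split.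
    + intros [Hx Ho]. split; [assumption|]. apply HA. now exists (S t).
    + intros [Hx HAx]. split; [assumption|].
      apply (outputs_prefix_mono M w T); [lia|auto].
  - rewrite prefix_mod by lia. specialize (Hlev t). unfold lev_at in Hlev.
    now apply Nat.ltb_lt.
Qed.

(** * Outer measure by clopen approximations *)

Open Scope R_scope.

Definition mu (L : nat) (P : nat -> bool) : R := INR (cnt (2 ^ L) P) * (/ 2) ^ L.

(* [X L] is the set of strings of length [L] whose cylinder is contained in the open
   set by stage [L]. *)
Definition open_cover (E : (nat -> bool) -> Prop) (X : nat -> nat -> bool) (r : R) : Prop :=
  (forall L s, (s < 2 ^ S L)%nat -> X L (s mod 2 ^ L) = true -> X (S L) s = true) /\
  (forall w, E w -> exists L, X L (oracle_prefix w L) = true) /\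
  (forall L, mu L (X L) <= r).

(** The outer measure of [E] is at most [r]; the slack [d] is there because an infimum need not be
    attained. *)
Definition outer_le (E : (nat -> bool) -> Prop) (r : R) : Prop :=
  forall d, 0 < d -> exists X, open_cover E X (r + d).

Lemma half_pow_pos L : 0 < (/ 2) ^ L.
Proof. apply pow_lt. lra. Qed.

Lemma pow2_half_pow L : INR (2 ^ L) * (/ 2) ^ L = 1.
Proof.
  rewrite pow_INR, <- Rpow_mult_distr. replace (INR 2 * / 2) with 1 by (simpl; lra).
  apply pow1.
Qed.

Lemma mu_true L : mu L (fun _ => true) = 1.
Proof. unfold mu. rewrite cnt_true. apply pow2_half_pow. Qed.

Lemma mu_nonneg L P : 0 <= mu L P.
Proof. apply Rmult_le_pos; [apply pos_INR|apply Rlt_le, half_pow_pos]. Qed.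

Lemma mu_le L P Q :
  (forall s, (s < 2 ^ L)%nat -> P s = true -> Q s = true) -> mu L P <= mu L Q.
Proof.
  intros H. apply Rmult_le_compat_r; [apply Rlt_le, half_pow_pos|].
  now apply le_INR, cnt_le.
Qed.

Lemma mu_union_inter L P Q :
  mu L (fun s => P s || Q s) + mu L (fun s => P s && Q s) = mu L P + mu L Q.
Proof.
  unfold mu. rewrite <- !Rmult_plus_distr_r, <- !plus_INR. now rewrite cnt_union_inter.
Qed.

Lemma mu_lift L P : mu (S L) (fun s => P (s mod 2 ^ L)) = mu L P.
Proof.
  unfold mu. rewrite Nat.pow_succ_r', cnt_double, mult_INR. simpl. lra.
Qed.

Lemma mu_open_mono X L L' :
  (forall L s, (s < 2 ^ S L)%nat -> X L (s mod 2 ^ L) = true -> X (S L) s = true) ->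
  (L <= L')%nat -> mu L (X L) <= mu L' (X L').
Proof.
  intros HX. induction 1 as [|L' _ IH]; [lra|]. eapply Rle_trans; [exact IH|].
  rewrite <- mu_lift. now apply mu_le, HX.
Qed.

Lemma open_prefix_mono X w L L' :
  (forall L s, (s < 2 ^ S L)%nat -> X L (s mod 2 ^ L) = true -> X (S L) s = true) ->
  (L <= L')%nat -> X L (oracle_prefix w L) = true -> X L' (oracle_prefix w L') = true.
Proof.
  intros HX. induction 1 as [|L' _ IH]; intros H; [assumption|].
  apply HX; [apply prefix_lt|]. rewrite prefix_mod by lia. auto.
Qed.

Lemma outer_exists E : exists e,
  (forall d, 0 < d -> exists X, open_cover E X (e + d)) /\
  (forall X r, open_cover E X r -> e <= r).
Proof.
  destruct (completeness (fun y => exists X, open_cover E X (- y))) as (m & Hub & Hlub).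
  - exists 0. intros y (X & _ & _ & H). pose proof (H 0%nat).
    pose proof (mu_nonneg 0 (X 0%nat)). lra.
  - exists (-1), (fun _ _ => true). split; [auto|split].
    + intros w _. now exists 0%nat.
    + intros L. rewrite mu_true. lra.
  - exists (- m). split.
    + intros d Hd. apply NNPP. intros Hno.
      enough (m <= m - d) by lra. apply Hlub. intros y (X & H).
      destruct (Rle_lt_dec y (m - d)) as [|Hlt]; [assumption|]. exfalso.
      apply Hno. exists X. destruct H as (H1 & H2 & H3). split; [assumption|split; [assumption|]].
      intros L. specialize (H3 L). lra.
    + intros X r H. enough (- r <= m) by lra. apply Hub. exists X.
      now rewrite Ropp_involutive.
Qed.

(** Continuity from below, for arbitrary sets. Let [e n] be the outer measure of [E n] and [X n] an
    open cover exceeding it by at most [d / 2 ^ (n + 1)]. By induction, the union [U n] of the first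
    covers exceeds [e n] by at most the sum of these errors. *)
Lemma outer_le_increasing_union (E : nat -> (nat -> bool) -> Prop) r :
  (forall n w, E n w -> E (S n) w) -> (forall n, outer_le (E n) r) ->
  outer_le (fun w => exists n, E n w) r.
Proof.
  intros Hinc Hr d Hd.
  assert (Hex : forall n, exists eX,
    open_cover (E n) (snd eX) (fst eX + d * (/ 2) ^ S n) /\
    forall X r, open_cover (E n) X r -> fst eX <= r).
  { intros n. destruct (outer_exists (E n)) as (e & He & Hmin).
    destruct (He (d * (/ 2) ^ S n)) as (X & HX).
    { apply Rmult_lt_0_compat; [assumption|apply half_pow_pos]. }
    exists (e, X). auto. }
  set (f n := constructive_indefinite_description _ (Hex n)).
  set (e n := fst (proj1_sig (f n))). set (X n := snd (proj1_sig (f n))).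
  assert (HX : forall n, open_cover (E n) (X n) (e n + d * (/ 2) ^ S n))
    by (intros n; apply (proj2_sig (f n))).
  assert (Hmin : forall n Y r, open_cover (E n) Y r -> e n <= r)
    by (intros n; apply (proj2_sig (f n))).
  clearbody e X. clear f.
  set (U n L s := bex (S n) (fun i => X i L s)).
  assert (HU : forall n L s, (s < 2 ^ S L)%nat ->
    U n L (s mod 2 ^ L) = true -> U n (S L) s = true).
  { intros n L s Hs H. apply bex_spec in H as (i & Hi & H). apply bex_spec.
    exists i. split; [assumption|]. now apply (HX i). }
  assert (HUS : forall n L s, U (S n) L s = U n L s || X (S n) L s).
  { intros n L s. apply eq_true_iff_eq. rewrite orb_true_iff. unfold U. rewrite !bex_spec.
    split.
    - intros (i & Hi & H). destruct (Nat.eq_dec i (S n)) as [->|]; [now right|].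
      left. exists i. split; [lia|assumption].
    - intros [(i & Hi & H)|H]; [exists i|exists (S n)]; (split; [lia|assumption]). }
  assert (Hbound : forall n L, mu L (U n L) <= e n + d * (1 - (/ 2) ^ S n)).
  { induction n as [|n IH]; intros L.
    - eapply Rle_trans; [apply (mu_le L _ (X 0%nat L))|].
      + intros s _ H. apply bex_spec in H as (i & Hi & H).
        now replace i with 0%nat in H by lia.
      + pose proof (proj2 (proj2 (HX 0%nat)) L). simpl in *. lra.
    (* The intersection still covers [E n], so by minimality its measure comes arbitrarily close to
       at least [e n]; inclusion-exclusion then bounds the union. *)
    - set (Y L s := U n L s && X (S n) L s).
      assert (HY : forall L s, (s < 2 ^ S L)%nat -> Y L (s mod 2 ^ L) = true -> Y (S L) s = true).
      { intros L' s Hs H. apply andb_true_iff in H as [H H'].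
        apply andb_true_iff. split; [now apply HU|now apply (HX (S n))]. }
      apply Rnot_lt_le. intros Hlt.
      set (eta := mu L (U (S n) L) - (e (S n) + d * (1 - (/ 2) ^ S (S n)))).
      assert (exists L', e n - eta < mu L' (Y L')) as (L1 & HL1).
      { apply NNPP. intros Hno. enough (e n <= e n - eta) by (unfold eta in *; lra).
        apply (Hmin n Y). split; [exact HY|]. split.
        - intros w Hw. destruct (proj1 (proj2 (HX n)) w Hw) as (L1 & H1).
          destruct (proj1 (proj2 (HX (S n))) w (Hinc n w Hw)) as (L2 & H2).
          exists (L1 + L2)%nat. apply andb_true_iff. split.
          + apply bex_spec. exists n. split; [lia|].
            apply (open_prefix_mono (X n) w L1); [apply (HX n)|lia|assumption].
          + apply (open_prefix_mono (X (S n)) w L2); [apply (HX (S n))|lia|assumption].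
        - intros L'. apply Rnot_lt_le. intros H. apply Hno. now exists L'. }
      set (L2 := (L + L1)%nat).
      assert (mu L (U (S n) L) <= mu L2 (U (S n) L2))
        by (apply (mu_open_mono (U (S n))); [apply HU|lia]).
      assert (mu L1 (Y L1) <= mu L2 (Y L2)) by (apply (mu_open_mono Y); [apply HY|lia]).
      pose proof (mu_union_inter L2 (U n L2) (X (S n) L2)) as Hui.
      assert (mu L2 (U (S n) L2) <= mu L2 (fun s => U n L2 s || X (S n) L2 s))
        by (apply mu_le; intros s _; now rewrite HUS).
      pose proof (IH L2). pose proof (proj2 (proj2 (HX (S n))) L2).
      change (mu L2 (fun s => U n L2 s && X (S n) L2 s)) with (mu L2 (Y L2)) in Hui.
      unfold eta in *. simpl in *. lra. }
  (* [U] grows in both arguments, so its diagonal enumerates the union of all the covers. *)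
  exists (fun L => U L L). split; [|split].
  - intros L s Hs H. rewrite HUS. apply orb_true_iff. left. now apply HU.
  - intros w (n & Hn). destruct (proj1 (proj2 (HX n)) w Hn) as (L & HL).
    exists (n + L)%nat. apply bex_spec. exists n. split; [lia|].
    apply (open_prefix_mono (X n) w L); [apply (HX n)|lia|assumption].
  - intros L. eapply Rle_trans; [apply Hbound|].
    assert (e L <= r).
    { apply Rnot_lt_le. intros H. destruct (Hr L ((e L - r) / 2)) as (Y & HY); [lra|].
      apply Hmin in HY. lra. }
    pose proof (Rmult_lt_0_compat _ _ Hd (half_pow_pos (S L))). lra.
Qed.

(* The index [2 ^ L + s] stands for the string [s] of length [L]. *)
Definition bits_of (L s : nat) : list bool := map (Nat.testbit s) (seq 0 L).

Lemma extends_bits_of w L : extends w (bits_of L (oracle_prefix w L)).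
Proof.
  intros i Hi. unfold bits_of in *. rewrite length_map, length_seq in Hi.
  rewrite (nth_indep _ false (Nat.testbit (oracle_prefix w L) 0))
    by now rewrite length_map, length_seq.
  now rewrite map_nth, seq_nth, testbit_prefix.
Qed.

(* The strings entering the open set at stage [L] are listed as cylinders; indices that
   contribute nothing are given cylinders of negligible total weight. *)
Lemma cover_of_open_cover E X r d : open_cover E X r -> 0 < d -> cover_bound E (r + d).
Proof.
  intros (HX & HE & Hmu) Hd.
  set (fresh L s := X L s && negb (match L with 0 => false | S L' => X L' (s mod 2 ^ L') end)).
  (* The filler at index [i] has length [i + J], so all fillers together weigh at most
     [2 * (/ 2) ^ J < d]. *)
  assert (exists J, (/ 2) ^ J < d / 2) as (J & HJ).
  { destruct (pow_lt_1_zero (/ 2)) with (y := d / 2) as (J & HJ).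
    - rewrite Rabs_pos_eq; lra.
    - lra.
    - exists J. specialize (HJ J (le_n J)).
      rewrite Rabs_pos_eq in HJ; [assumption|apply Rlt_le, half_pow_pos]. }
  set (sigma i := let L := Nat.log2 i in
    if (0 <? i)%nat && fresh L (i - 2 ^ L)%nat then bits_of L (i - 2 ^ L)
    else repeat false (i + J)).
  assert (Hlog : forall L s, (s < 2 ^ L)%nat -> Nat.log2 (2 ^ L + s) = L).
  { intros L s Hs. apply Nat.log2_unique; [lia|]. rewrite Nat.pow_succ_r'. lia. }
  exists sigma. split.
  - intros w Hw.
    assert (exists L, fresh L (oracle_prefix w L) = true) as (L & HL).
    { destruct (HE w Hw) as (L & HL). induction L as [|L IH].
      - exists 0%nat. unfold fresh. now rewrite HL.
      - destruct (X L (oracle_prefix w L)) eqn:E1; [auto|].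
        exists (S L). unfold fresh. rewrite HL, prefix_mod, E1 by lia. reflexivity. }
    pose proof (prefix_lt w L) as Hlt. exists (2 ^ L + oracle_prefix w L)%nat.
    unfold sigma. cbv zeta. rewrite Hlog by assumption.
    replace (2 ^ L + oracle_prefix w L - 2 ^ L)%nat with (oracle_prefix w L) by lia.
    rewrite HL, (proj2 (Nat.ltb_lt 0 _)) by (pose proof (pow2_pos L); lia).
    apply extends_bits_of.
  - assert (Hblock : forall n j, (j <= 2 ^ n)%nat ->
      partial_weight sigma (2 ^ n + j) <= partial_weight sigma (2 ^ n) +
        INR (cnt j (fresh n)) * (/ 2) ^ n +
        (/ 2) ^ J * (2 * (/ 2) ^ (2 ^ n) - 2 * (/ 2) ^ (2 ^ n + j))).
    { intros n j. induction j as [|j IH]; intros Hj.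
      - rewrite Nat.add_0_r. simpl. lra.
      - rewrite Nat.add_succ_r. cbn [partial_weight]. specialize (IH ltac:(lia)).
        rewrite cnt_S, plus_INR.
        assert ((/ 2) ^ length (sigma (2 ^ n + j)%nat) <=
          INR (Nat.b2n (fresh n j)) * (/ 2) ^ n + (/ 2) ^ J * (/ 2) ^ (2 ^ n + j)) as H.
        { rewrite <- pow_add. unfold sigma. cbv zeta. rewrite Hlog by lia.
          replace (2 ^ n + j - 2 ^ n)%nat with j by lia.
          rewrite (proj2 (Nat.ltb_lt 0 _)) by (pose proof (pow2_pos n); lia).
          destruct (fresh n j); simpl andb; cbv iota.
          - unfold bits_of. rewrite length_map, length_seq. simpl INR.
            pose proof (half_pow_pos (J + (2 ^ n + j))). lra.
          - rewrite repeat_length, (Nat.add_comm J). simpl INR. lra. }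
        change ((/ 2) ^ S (2 ^ n + j)) with (/ 2 * (/ 2) ^ (2 ^ n + j)). lra. }
    (* Fresh strings do not extend strings of the previous stage, so the weights of the stages
       telescope. *)
    assert (Hfresh : forall n, mu (S n) (fresh (S n)) + mu n (X n) <= mu (S n) (X (S n))).
    { intros n. rewrite <- (mu_lift n (X n)), <- mu_union_inter.
      rewrite (Rplus_comm (mu _ _)).
      replace (mu (S n) (fun s => fresh (S n) s && X n (s mod 2 ^ n))) with 0.
      - rewrite Rplus_0_l. apply mu_le. intros s Hs H. apply orb_true_iff in H as [H|H].
        + now apply andb_true_iff in H.
        + now apply HX.
      - unfold mu. rewrite (proj2 (cnt_0 _ _)); [simpl; lra|].
        intros s _. unfold fresh. destruct (X n (s mod 2 ^ n)); simpl.
        + now rewrite andb_false_r.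
        + apply andb_false_r. }
    assert (Htotal : forall n, partial_weight sigma (2 ^ S n) <=
      mu n (X n) + (/ 2) ^ J * (2 - 2 * (/ 2) ^ (2 ^ S n))).
    { induction n as [|n IH].
      - pose proof (Hblock 0%nat 1%nat (le_n _)) as H.
        change (2 ^ 0 + 1)%nat with 2%nat in H. change (2 ^ 1)%nat with 2%nat.
        change (2 ^ 0)%nat with 1%nat in H.
        assert (partial_weight sigma 1 = (/ 2) ^ J) as H1.
        { cbn [partial_weight]. change (sigma 0%nat) with (repeat false J).
          rewrite repeat_length. lra. }
        assert (INR (cnt 1 (fresh 0%nat)) * (/ 2) ^ 0 <= mu 0 (X 0%nat)) as H2.
        { unfold mu. change (2 ^ 0)%nat with 1%nat. apply Rmult_le_compat_r; [simpl; lra|].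
          apply le_INR, cnt_le. intros s _ Hs. now apply andb_true_iff in Hs. }
        rewrite H1 in H. simpl ((/ 2) ^ 1) in H. lra.
      - pose proof (Hblock (S n) (2 ^ S n)%nat (le_n _)) as H.
        replace (2 ^ S n + 2 ^ S n)%nat with (2 ^ S (S n))%nat in H
          by (rewrite (Nat.pow_succ_r' 2 (S n)); lia).
        pose proof (Hfresh n) as H1. unfold mu at 1 in H1. lra. }
    assert (Hmono : forall N N', (N <= N')%nat ->
      partial_weight sigma N <= partial_weight sigma N').
    { intros N N'. induction 1 as [|N' _ IH]; [lra|]. cbn [partial_weight].
      pose proof (half_pow_pos (length (sigma N'))). lra. }
    intros N. eapply Rle_trans; [apply (Hmono N (2 ^ S N)%nat)|].
    + pose proof (pow2_gt (S N)). lia.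
    + eapply Rle_trans; [apply Htotal|]. pose proof (Hmu N).
      pose proof (Rmult_lt_0_compat _ _ (half_pow_pos J) (half_pow_pos (2 ^ S N))). lra.
Qed.

Lemma outer_le_subset E F r : (forall w, E w -> F w) -> outer_le F r -> outer_le E r.
Proof.
  intros H HF d Hd. destruct (HF d Hd) as (X & H1 & H2 & H3). exists X.
  split; [assumption|split; [auto|assumption]].
Qed.

Lemma mod_pow2_mod s n L : (n <= L)%nat -> ((s mod 2 ^ L) mod 2 ^ n = s mod 2 ^ n)%nat.
Proof.
  intros H. apply (testbit_inj_lt n).
  - apply Nat.mod_upper_bound. pose proof (pow2_pos n). lia.
  - apply Nat.mod_upper_bound. pose proof (pow2_pos n). lia.
  - intros i Hi. rewrite !testbit_mod_pow2; auto; lia.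
Qed.

Lemma outer_le_clopen E n P r :
  (forall w, E w -> P (oracle_prefix w n) = true) -> mu n P <= r -> outer_le E r.
Proof.
  intros HE Hr d Hd. exists (fun L s => (n <=? L)%nat && P (s mod 2 ^ n)%nat).
  split; [|split].
  - intros L s _ H. apply andb_true_iff in H as [HL H]. apply Nat.leb_le in HL.
    rewrite mod_pow2_mod in H by assumption. apply andb_true_iff.
    split; [apply Nat.leb_le; lia|assumption].
  - intros w Hw. exists n. rewrite Nat.leb_refl, prefix_mod by lia. now apply HE.
  - intros L. destruct (Nat.leb_spec n L) as [H|H].
    + enough (mu L (fun s => P (s mod 2 ^ n)%nat) = mu n P) as E1 by (simpl; lra).
      induction H as [|L H IH].
      * unfold mu. do 2 f_equal. apply cnt_ext. intros s Hs. now rewrite Nat.mod_small.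
      * rewrite <- IH, <- (mu_lift L (fun s => P (s mod 2 ^ n)%nat)).
        unfold mu. do 2 f_equal. apply cnt_ext. intros s _. now rewrite mod_pow2_mod.
    + unfold mu. rewrite (proj2 (cnt_0 _ _)) by reflexivity. simpl INR.
      pose proof (mu_nonneg n P). lra.
Qed.

(** Otherwise the sequences enumerating [A] form an increasing union over bounds [N] on their
    levels, and each part is covered by an increasing union over the stage [T] from which on its
    sequences are pending. By [pending_light] each final part lies in a clopen set of measure below
    [2 ^ - k], so [p] would be at most [2 ^ - k]. *)
Lemma served_infinitely_often M k A p :
  prob_of M A p -> (/ 2) ^ k < p ->
  exists w, (forall x, A x <-> enumerated M w x) /\
    forall T, exists t, (T <= t)%nat /\ served_at M k w t.
Proof.
  intros [Hlow _] Hp. apply NNPP. intros Hno.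
  set (E w := prob_enumerates M w A) in *.
  assert (forall w, E w -> forall x, A x <-> enumerated M w x) as HEA
    by (intros w Hw; now apply prob_enumerates_spec).
  enough (outer_le E ((/ 2) ^ k)) as HE.
  { destruct (HE ((p - (/ 2) ^ k) / 4)) as (X & HX); [lra|].
    apply (cover_of_open_cover _ _ _ ((p - (/ 2) ^ k) / 4)) in HX; [|lra].
    apply Hlow in HX. lra. }
  set (EN N w := E w /\ forall t, (lev_at M k w t < N)%nat).
  apply (outer_le_subset _ (fun w => exists N, EN N w)).
  { intros w Hw.
    assert (exists T, forall t, (T <= t)%nat -> ~ served_at M k w t) as (T & HT).
    { apply NNPP. intros H. apply Hno. exists w. split; [now apply HEA|].
      intros T. apply NNPP. intros H'. apply H. exists T. intros t Ht Hs. apply H'. eauto. }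
    exists (S (lev_at M k w T)). split; [assumption|]. intros t.
    destruct (Nat.le_ge_cases t T) as [Ht|Ht].
    - pose proof (lev_at_mono M k w t T Ht). lia.
    - enough (lev_at M k w t = lev_at M k w T) by lia.
      induction Ht as [|t Ht IH]; [reflexivity|]. rewrite <- IH.
      apply lev_at_not_served. now apply HT. }
  apply outer_le_increasing_union.
  { intros N w [Hw H]. split; [assumption|]. intros t. specialize (H t). lia. }
  intros N.
  set (V := bitsum N (fun x => if excluded_middle_informative (A x) then true else false)).
  assert (HV : forall x, Nat.testbit V x = true <-> (x < N)%nat /\ A x).
  { intros x. unfold V. rewrite testbit_bitsum, andb_true_iff, Nat.ltb_lt.
    destruct (excluded_middle_informative (A x)); intuition discriminate. }
  set (ENT T w := forall t, (T <= t)%nat -> pending M k N V t (oracle_prefix w (S t)) = true).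
  apply (outer_le_subset _ (fun w => exists T, ENT T w)).
  { intros w [Hw H]. apply (pending_eventually M k w A N V); auto. }
  apply outer_le_increasing_union.
  { intros T w H t Ht. apply H. lia. }
  intros T. destruct (pending_light M k N V T) as (t & Ht & Hlt).
  apply (outer_le_clopen _ (S t) (fun s => pending M k N V t s)).
  { intros w Hw. now apply Hw. }
  apply lt_INR in Hlt. rewrite mult_INR in Hlt. unfold mu.
  set (c := INR (cnt (2 ^ S t) (fun s => pending M k N V t s))) in *.
  pose proof (pow2_half_pow k). pose proof (pow2_half_pow (S t)).
  pose proof (half_pow_pos k). pose proof (half_pow_pos (S t)).
  apply Rmult_lt_compat_r with (r := (/ 2) ^ S t) in Hlt; [|assumption].
  apply Rmult_lt_compat_r with (r := (/ 2) ^ k) in Hlt; [|assumption].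
  replace (INR (2 ^ k) * c * (/ 2) ^ S t * (/ 2) ^ k)
    with (INR (2 ^ k) * (/ 2) ^ k * (c * (/ 2) ^ S t)) in Hlt by ring.
  rewrite H, H0, !Rmult_1_l in Hlt. lra.
Qed.

(** * Descriptions *)

(* The number [2 ^ k * 2 ^ k + a] with [a < 2 ^ k * 2 ^ k] describes the token [a] in the
   run with parameter [k]. *)
Definition description_level (X : nat) : nat := bmin (S X) (fun k => X <? 2 ^ S k * 2 ^ S k)%nat.

(** At stage [t] only the element [level t] is tested; since levels recur and positions grow, every
    element of the limit is emitted eventually. *)
Definition follow_token (M : prog) (X t : nat) : nat :=
  let k := description_level X in
  if Nat.testbit (tok (state M k t) (X - 2 ^ k * 2 ^ k)) (level t)
  then S (level t) else 0%nat.

Lemma cpt_description_level : cpt1 description_level.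
Proof. unfold cpt1, description_level. cpt_tac. Qed.
#[local] Hint Resolve cpt_description_level cpt_state : cpt.

Lemma cpt_follow_token M : cpt2 (follow_token M).
Proof. unfold cpt2, follow_token. cbv zeta. cpt_tac. Qed.

Lemma description_level_spec k a :
  (a < 2 ^ k * 2 ^ k)%nat -> description_level (2 ^ k * 2 ^ k + a) = k.
Proof.
  intros Ha. pose proof (pow2_gt k). apply bmin_unique.
  - nia.
  - intros i Hi. apply Nat.ltb_ge.
    assert (2 ^ S i <= 2 ^ k)%nat by (apply Nat.pow_le_mono_r; lia). nia.
  - intros _. apply Nat.ltb_lt. rewrite Nat.pow_succ_r'. nia.
Qed.

Lemma code_surjective X : exists x, code x = X.
Proof.
  induction X as [X IH] using lt_wf_ind.
  destruct (Nat.Even_or_Odd X) as [(q & ->)|(q & ->)].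
  - destruct q as [|q]; [now exists []|]. destruct (IH q) as (x & <-); [lia|].
    exists (true :: x). simpl. lia.
  - destruct (IH q) as (x & <-); [lia|]. exists (false :: x). simpl. lia.
Qed.

(** The smallest code of a string of length [n] is [2 ^ n - 1], attained when all bits are
    [false]. *)
Lemma length_code x : (2 ^ length x <= S (code x))%nat.
Proof. induction x as [|[] x IH]; simpl; lia. Qed.

Lemma token_machine M : exists D : prog, forall k a A,
  (a < 2 ^ k * 2 ^ k)%nat ->
  (forall x, (exists t, Nat.testbit (tok (state M k t) a) x = true) <-> A x) ->
  exists d, det_enumerates D d A /\ (length d <= 2 * k + 1)%nat.
Proof.
  destruct (cpt_follow_token M) as (D & _ & _ & HD). exists D. intros k a A Ha HA.
  destruct (code_surjective (2 ^ k * 2 ^ k + a)) as (d & Hd). exists d. split.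
  - assert (Hout : forall t, eval (fun _ => false) D [code d; t]
      (if Nat.testbit (tok (state M k t) a) (level t) then S (level t) else 0%nat)).
    { intros t. specialize (HD (fun _ => false) [code d; t]). cbn [nth] in HD.
      unfold follow_token in HD. cbv zeta in HD.
      rewrite Hd, description_level_spec in HD by assumption.
      replace (2 ^ k * 2 ^ k + a - 2 ^ k * 2 ^ k)%nat with a in HD by lia.
      now rewrite Hd. }
    intros x. rewrite <- HA. split.
    + intros (t & Hx). destruct (level_recurrent x t) as (t' & Ht & Hlev).
      exists (S t'). specialize (Hout (S t')). rewrite Hlev in Hout.
      assert (sub (tok (state M k t) a) (tok (state M k (S t')) a) = true) as Hsub
        by (apply tok_mono; auto).
      rewrite sub_spec in Hsub. now rewrite Hsub in Hout.
    + intros (t & Hx). exists t. pose proof (eval_functional _ _ _ _ _ Hx (Hout t)) as Heq.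
      destruct (Nat.testbit (tok (state M k t) a) (level t)) eqn:E; [|discriminate].
      injection Heq as ->. assumption.
  (* The described number is below [2 * 4 ^ k], whence [2 * k + 1] bits. *)
  - pose proof (length_code d) as Hl. rewrite Hd in Hl.
    apply (Nat.pow_le_mono_r_iff 2); [lia|].
    rewrite Nat.pow_add_r, Nat.mul_comm, Nat.pow_1_r.
    replace (2 * k)%nat with (k + k)%nat by lia. rewrite Nat.pow_add_r. lia.
Qed.

(** * The bound on the description length *)

Lemma cantor_measure_le_1 A p : cantor_measure A p -> p <= 1.
Proof.
  intros [Hlow _]. apply Rnot_lt_le. intros Hp.
  enough (p <= 1 + (p - 1) / 2) by lra. apply Hlow.
  apply (cover_of_open_cover _ (fun _ _ => true)); [|lra].
  split; [auto|split].
  - intros w _. now exists 0%nat.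
  - intros L. rewrite mu_true. lra.
Qed.

(* For any universal deterministic enumerator D0 and optimal probabilistic
   enumerator M0 there is C such that whenever H(S) = h < oo, some
   description x of S for D0 has length <= 2h + C log2(h+2) + C,
   i.e. I(S) <= 2 H(S) + C log2(H(S)+2) + C. *)
Theorem theorem4 :
  forall D0 M0 : prog, universal_det D0 -> optimal_prob M0 ->
  exists C : R, forall (S : nat -> Prop) (h : R),
    H_is M0 S h ->
    exists x : list bool, det_enumerates D0 x S /\
      INR (length x) <= 2 * h + C * log2 (h + 2) + C.
Proof.
  intros D0 M0 Huniv _. destruct (token_machine M0) as (D & HD).
  (* With [k <= h + 1] the length is at most [2 * k + 1 + c <= 2 * h + 3 + c]. *)
  destruct (Huniv D) as (c & Hc). exists (INR c + 3). intros A h (p & Hprob & Hp & ->).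
  pose proof (cantor_measure_le_1 _ _ Hprob) as Hp1.
  assert (0 < ln 2) as Hln2 by (rewrite <- ln_1; apply ln_increasing; lra).
  assert (0 <= - log2 p) as Hh.
  { unfold log2. enough (ln p / ln 2 <= 0) by lra.
    apply Rmult_le_reg_r with (ln 2); [assumption|]. unfold Rdiv.
    rewrite Rmult_assoc, Rinv_l, Rmult_1_r, Rmult_0_l by lra.
    rewrite <- ln_1. destruct Hp1 as [Hlt| ->]; [left; apply ln_increasing; assumption|lra]. }
  set (h := - log2 p) in *.
  destruct (archimed h) as [Hup1 Hup2].
  assert (0 <= up h)%Z as Hup by (apply le_IZR; lra).
  (* [up h] is strictly above [h], which makes [2 ^ - k] strictly smaller than [p]. *)
  set (k := Z.to_nat (up h)).
  assert (INR k = IZR (up h)) as Hk by (unfold k; rewrite INR_IZR_INZ, Z2Nat.id; auto).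
  assert ((/ 2) ^ k < p) as Hkp.
  { apply ln_lt_inv; [apply half_pow_pos|assumption|].
    rewrite ln_pow, ln_Rinv, Hk by lra.
    assert (ln p = - h * ln 2) as -> by (unfold h, log2; field; lra). nra. }
  destruct (served_infinitely_often M0 k A p Hprob Hkp) as (w & Hw & Hinf).
  destruct (token_limit M0 k w Hinf) as (a & Ha & Htok).
  destruct (HD k a A Ha) as (d & Hd & Hlen).
  { intros x. rewrite Htok. symmetry. apply Hw. }
  destruct (Hc A d Hd) as (x & Hx & Hlx). exists x. split; [assumption|].
  assert (INR (length x) <= 2 * INR k + 1 + INR c) as Hlx'.
  { replace 2 with (INR 2) by reflexivity. rewrite <- mult_INR, <- S_INR, <- plus_INR.
    apply le_INR. lia. }
  assert (0 <= log2 (h + 2)) as Hlog.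
  { unfold log2. apply Rmult_le_pos; [|left; apply Rinv_0_lt_compat; assumption].
    rewrite <- ln_1. left. apply ln_increasing; lra. }
  pose proof (Rmult_le_pos _ _ (Rplus_le_le_0_compat _ 3 (pos_INR c) ltac:(lra)) Hlog).
  lra.
Qed.
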